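(* Let $(W,S)$ be a Coxeter system, let $\mathscr I$ be an ideal of $(W,\leqslant_L)$ and let $J\subseteq \mathrm{Pos}(\mathscr I)$. Then $(\mathscr I,J)$ is a $W$-graph ideal if and only if the following construction, for some sequence of choices of the elements $s$ in it, produces a $W$-graph $\Gamma=(C,\mu,\tau)$ such that the formulas $( * )$ below hold in $M_\Gamma$. Construction. Put $q_{y,w}=0$ whenever $y,w\in\mathscr I$ and $y\not<w$, and let $\mu_{y,w}$ always denote the constant term of $q_{y,w}$. Recursively on $l(z)$, for each $z\in\mathscr I$ with $z\neq1$, choose $s\in S$ with $l(sz)<l(z)$, put $w=sz$, set $q_{w,z}=1$, and for every $y\in\mathscr I$ with $y<z$ and $y\ne w$ define $q_{y,z}\in\mathbb Z[q]$ by: (1) $q_{y,z}=q\,q_{y,w}$ if $s\in\mathrm A(y)$; (2) $q_{y,z}=-q^{-1}(q_{y,w}-\mu_{y,w})+q_{sy,w}+\sum_x\mu_{y,x}q_{x,w}$ if $s\in\mathrm{SD}(y)$; (3) $q_{y,z}=-q^{-1}(q_{y,w}-\mu_{y,w})+\sum_x\mu_{y,x}q_{x,w}$ if $s\in\mathrm{WD}(y)$; where the sums are over all $x\in\mathscr I$ with $y<x<w$ and $s\notin\mathrm D(x)$. Let $C=\{c_w\mid w\in\mathscr I\}$ be a set in bijection with $\mathscr I$, let $\mu(c_y,c_w)=\mu_{y,w}$ if $y<w$, $\mu(c_y,c_w)=\mu_{w,y}$ if $w<y$, and $\mu(c_y,c_w)=0$ otherwise, and let $\tau(c_w)=\mathrm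 D(w)$. Formulas $( * )$: for all $s\in S$ and $w\in\mathscr I$, with $\mathcal R(s,w)=\{y\in\mathscr I\mid y<w,\ s\in\mathrm D(y)\}$, $$T_sc_w=\begin{cases}-q^{-1}c_w&\text{if }s\in\mathrm D(w),\\ qc_w+\sum_{y\in\mathcal R(s,w)}\mu_{y,w}c_y&\text{if }s\in\mathrm{WA}(w),\\ qc_w+c_{sw}+\sum_{y\in\mathcal R(s,w)}\mu_{y,w}c_y&\text{if }s\in\mathrm{SA}(w).\end{cases}$$
   Context: Coxeter groups and Hecke algebras. $(W,S)$ is a Coxeter system with length function $l$; $\leqslant$ is the Bruhat order, and $\leqslant_L$ is the left weak order: $v\leqslant_L w$ iff $l(w)=l(wv^{-1})+l(v)$. An ideal of $(W,\leqslant_L)$ is a nonempty subset $\mathscr I\subseteq W$ such that $v\leqslant_L w\in\mathscr I$ implies $v\in\mathscr I$. For $X\subseteq W$, $\mathrm{Pos}(X)=\{s\in S\mid l(xs)>l(x)\text{ for all }x\in X\}$. For $J\subseteq S$, $D_J=\{w\in W\mid l(ws)>l(w)\text{ for all }s\in J\}$. $\mathcal A=\mathbb Z[q,q^{-1}]$, $\mathcal A^+=\mathbb Z[q]$, and $a\mapsto\overline a$ is the ring automorphism of $\mathcal A$ with $\overline q=q^{-1}$. The Hecke algebra $\mathcal H=\mathcal H(W)$ is the associative $\mathcal A$-algebra generated by $\{T_s\mid s\in S\}$ with relations $T_s^2=1+(q-q^{-1})T_s$ and the braid relations $T_sT_tT_s\cdots=T_tT_sT_t\cdots$ ($m(s,t)$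 factors on each side, $m(s,t)$ the order of $st$). It has the $\mathcal A$-semilinear ring involution $h\mapsto\overline h$ with $\overline{T_s}=T_s^{-1}=T_s-(q-q^{-1})$. $W$-graphs. A $W$-graph is a triple $\Gamma=(V,\mu,\tau)$ with $V$ a set, $\mu\colon V\times V\to\mathbb Z$, and $\tau$ a function from $V$ to the power set of $S$, such that the free $\mathcal A$-module $M_\Gamma$ with basis $V$ admits an $\mathcal H$-module structure with $T_sv=-q^{-1}v$ if $s\in\tau(v)$ and $T_sv=qv+\sum_{u\in V,\,s\in\tau(u)}\mu(u,v)u$ if $s\notin\tau(v)$. $W$-graph ideals. Let $\mathscr I$ be an ideal of $(W,\leqslant_L)$ and $J\subseteq\mathrm{Pos}(\mathscr I)$ (equivalently $\mathscr I\subseteq D_J$). For $w\in\mathscr I$ put $\mathrm{SD}(w)=\{s\in S\mid sw<w\}$, $\mathrm{SA}(w)=\{s\mid sw>w,\ sw\in\mathscr I\}$, $\mathrm{WD}(w)=\{s\mid sw>w,\ sw\notin D_J\}$, $\mathrm{WA}(w)=\{s\mid sw>w,\ sw\in D_J\setminus\mathscr I\}$, $\mathrm D(w)=\mathrm{SD}(w)\cup\mathrm{WD}(w)$ and $\mathrm A(w)=\mathrm{SA}(w)\cup\mathrm{WA}(w)$. The pair $(\mathscr I,J)$ is a $W$-graph ideal if there is an $\mathcal H$-module $\mathscr S$ such that: (i) $\mathscr S$ has an $\mathcal A$-basis $\{b_w\mid w\in\mathscr I\}$ with $T_sb_w=b_{sw}$ if $s\in\mathrm{SA}(w)$; $T_sb_w=b_{sw}+(q-q^{-1})b_w$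 if $s\in\mathrm{SD}(w)$; $T_sb_w=-q^{-1}b_w$ if $s\in\mathrm{WD}(w)$; $T_sb_w=qb_w-\sum_{y\in\mathscr I,\,y<sw}r^s_{y,w}b_y$ for some $r^s_{y,w}\in q\mathcal A^+$ if $s\in\mathrm{WA}(w)$; and (ii) $\mathscr S$ admits an $\mathcal A$-semilinear involution $\alpha\mapsto\overline\alpha$ with $\overline{b_1}=b_1$ and $\overline{h\alpha}=\overline h\,\overline\alpha$ for all $h\in\mathcal H$, $\alpha\in\mathscr S$. *)

(* Defs.v *)
From HB Require Import structures.
From mathcomp Require Import all_boot all_order all_algebra.
From mathcomp Require Import all_classical.
From mathcomp Require Import ring.
From Stdlib Require Import Relations.Relation_Operators.

Set Implicit Arguments.
Unset Strict Implicit.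
Unset Printing Implicit Defensive.

Import Order.TTheory GRing.Theory.
Local Open Scope classical_set_scope.
Local Open Scope ring_scope.

(* The Laurent polynomial ring Z[q, q^-1], realised inside the fraction field *)
(* of Z[X] as the set of fractions p / X^n; q is the image of X.              *)

Definition is_laurent (x : {fraction {poly int}}) : bool :=
  `[< exists (p : {poly int}) (n : nat),
        x * FracField.tofrac 'X ^+ n = FracField.tofrac p >].

Lemma is_laurent_subring : subring_closed is_laurent.
Proof.
split=> [|x y /asboolP[p [m xE]] /asboolP[r [n yE]]|
          x y /asboolP[p [m xE]] /asboolP[r [n yE]]].
- by apply/asboolP; exists 1, 0%N; rewrite expr0 mulr1 rmorph1.
- apply/asboolP; exists (p * 'X^n - r * 'X^m), (m + n)%N.
  by rewrite rmorphB !rmorphM !rmorphXn/= -xE -yE exprD; ring.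
- apply/asboolP; exists (p * r), (m + n)%N.
  by rewrite rmorphM/= -xE -yE exprD; ring.
Qed.

HB.instance Definition _ :=
  GRing.isSubringClosed.Build _ is_laurent is_laurent_subring.

Record laurent := Laurent {
  laurent_val :> {fraction {poly int}};
  laurentP : is_laurent laurent_val }.

HB.instance Definition _ := [isSub for laurent_val].
HB.instance Definition _ := [Choice of laurent by <:].
HB.instance Definition _ := [SubChoice_isSubComNzRing of laurent by <:].

Lemma laurent_poly_proof (p : {poly int}) : is_laurent (FracField.tofrac p).
Proof. by apply/asboolP; exists p, 0%N; rewrite expr0 mulr1. Qed.

Definition lpoly (p : {poly int}) : laurent := Laurent (laurent_poly_proof p).

Lemma lpoly_zmod_morphism : zmod_morphism lpoly.
Proof. by move=> p r; apply: val_inj; rewrite /= rmorphB. Qed.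
HB.instance Definition _ :=
  GRing.isZmodMorphism.Build {poly int} laurent lpoly lpoly_zmod_morphism.

Lemma lpoly_monoid_morphism : monoid_morphism lpoly.
Proof. by split=> [|p r]; apply: val_inj; rewrite /= ?rmorph1 ?rmorphM. Qed.
HB.instance Definition _ :=
  GRing.isMonoidMorphism.Build {poly int} laurent lpoly lpoly_monoid_morphism.

Lemma lpoly_inj : injective lpoly.
Proof. by move=> p r /(congr1 val)/eqP; rewrite tofrac_eq => /eqP. Qed.

Lemma laurent_qV_proof : is_laurent (FracField.tofrac 'X)^-1.
Proof.
apply/asboolP; exists 1, 1%N.
by rewrite expr1 rmorph1 mulVf// tofrac_eq0 polyX_eq0.
Qed.

Definition lq : laurent := lpoly 'X.
Definition lqV : laurent := Laurent laurent_qV_proof.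

Lemma lqVK : lqV * lq = 1.
Proof. by apply: val_inj; rewrite /= mulVf// tofrac_eq0 polyX_eq0. Qed.

Lemma lqKV : lq * lqV = 1.
Proof. by rewrite mulrC lqVK. Qed.

Lemma laurent_decomp (a : laurent) :
  exists pn : {poly int} * nat, a = lpoly pn.1 * lqV ^+ pn.2.
Proof.
have /asboolP[p [n aE]] := laurentP a; exists (p, n); apply: val_inj.
rewrite [RHS](rmorphM \val) [X in _ * X](rmorphXn \val)/= -aE -mulrA -exprMn.
by rewrite mulfV ?expr1n ?mulr1// tofrac_eq0 polyX_eq0.
Qed.

(* q A^+ = q Z[q] *)
Definition lqZq : set laurent := [set lq * lpoly p | p in [set: {poly int}]].

(* p(q) |-> p(q^-1) *)
Definition lpolyV (p : {poly int}) : laurent := (map_poly intr p).[lqV].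

Lemma lpolyVM p r : lpolyV (p * r) = lpolyV p * lpolyV r.
Proof. by rewrite /lpolyV rmorphM hornerM. Qed.

Lemma lpolyVB p r : lpolyV (p - r) = lpolyV p - lpolyV r.
Proof. by rewrite /lpolyV rmorphB hornerD hornerN. Qed.

Lemma lpolyVXn n : lpolyV 'X^n = lqV ^+ n.
Proof. by rewrite /lpolyV map_polyXn hornerXn. Qed.

(* The bar automorphism q |-> q^-1 of Z[q, q^-1]. *)
Definition lbar (a : laurent) : laurent :=
  let pn := projT1 (cid (laurent_decomp a)) in lpolyV pn.1 * lq ^+ pn.2.

Lemma lbarE p n : lbar (lpoly p * lqV ^+ n) = lpolyV p * lq ^+ n.
Proof.
rewrite /lbar; case: cid => -[r m] /= e.
have {}e : p * 'X^m = r * 'X^n.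
  apply: lpoly_inj; rewrite !rmorphM !rmorphXn/= -/lq.
  have := congr1 (fun x => x * lq ^+ n * lq ^+ m) e.
  rewrite -[_ * lq ^+ n]mulrA -exprMn lqVK expr1n mulr1 => ->.
  by rewrite mulrAC -[_ * lq ^+ m]mulrA -exprMn lqVK expr1n mulr1.
have := congr1 (fun x => lpolyV x * lq ^+ m * lq ^+ n) e.
rewrite !lpolyVM !lpolyVXn -[_ * lq ^+ m]mulrA -exprMn lqVK expr1n mulr1 => ->.
by rewrite mulrAC -[_ * lq ^+ n]mulrA -exprMn lqVK expr1n mulr1.
Qed.

Lemma lbar_zmod_morphism : zmod_morphism lbar.
Proof.
move=> a b; have [[p m] ->] := laurent_decomp a.
have [[r n] ->] := laurent_decomp b; rewrite /= !lbarE.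
have -> : lpoly p * lqV ^+ m - lpoly r * lqV ^+ n =
          lpoly (p * 'X^n - r * 'X^m) * lqV ^+ (m + n).
  rewrite rmorphB !rmorphM !rmorphXn/= -/lq exprD.
  have H k : lq ^+ k * lqV ^+ k = 1 by rewrite -exprMn lqKV expr1n.
  rewrite mulrBl; congr (_ - _).
    by rewrite -mulrA [_ ^+ n * _]mulrCA H mulr1.
  by rewrite -mulrA [_ ^+ m * (_ * _)]mulrA H mul1r.
rewrite lbarE lpolyVB !lpolyVM !lpolyVXn exprD mulrBl.
have H k : lqV ^+ k * lq ^+ k = 1 by rewrite -exprMn lqVK expr1n.
congr (_ - _).
  by rewrite -mulrA [_ ^+ n * _]mulrCA H mulr1.
by rewrite -mulrA [_ ^+ m * (_ * _)]mulrA H mul1r.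
Qed.
HB.instance Definition _ :=
  GRing.isZmodMorphism.Build laurent laurent lbar lbar_zmod_morphism.

Lemma lbar_lpoly p : lbar (lpoly p) = lpolyV p.
Proof. by have := lbarE p 0; rewrite !expr0 !mulr1. Qed.

Lemma lbar_monoid_morphism : monoid_morphism lbar.
Proof.
split=> [|a b].
  by have := lbar_lpoly 'X^0; rewrite lpolyVXn !expr0 (rmorph1 lpoly).
have [[p m] ->] := laurent_decomp a.
have [[r n] ->] := laurent_decomp b.
by rewrite /= mulrACA -rmorphM -exprD !lbarE lpolyVM exprD mulrACA.
Qed.
HB.instance Definition _ :=
  GRing.isMonoidMorphism.Build laurent laurent lbar lbar_monoid_morphism.

Lemma lbarq : lbar lq = lqV.
Proof. by rewrite lbar_lpoly (lpolyVXn 1). Qed.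

Lemma lbarqV : lbar lqV = lq.
Proof.
have e : lbar lqV * lqV = 1 by rewrite -{2}lbarq -rmorphM lqVK rmorph1.
by rewrite -[LHS]mulr1 -lqVK mulrA e mul1r.
Qed.

Lemma lbarK : involutive lbar.
Proof.
move=> a; have [[p n] ->] := laurent_decomp a.
rewrite /= lbarE (rmorphM lbar) (rmorphXn lbar) /= lbarq; congr (_ * _).
rewrite /lpolyV -[LHS](horner_map lbar) /= lbarqV -map_poly_comp.
rewrite (eq_map_poly (g := intr)); last by move=> z /=; rewrite rmorph_int.
rewrite /lq -[in RHS](comp_polyXr p) /comp_poly -horner_map/=; congr _.[_].
rewrite -map_poly_comp; apply: eq_map_poly => z /=.
by rewrite -[in RHS](intz z) !rmorph_int.
Qed.

Definition has_order (G : groupType) (x : G) (m : nat) : Prop :=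
  [/\ (0 < m)%N, (x ^+ m)%g = 1%g &
      forall k, (0 < k < m)%N -> (x ^+ k)%g <> 1%g].

(* x y x y ... with n factors *)
Fixpoint altprod (R : pzRingType) (x y : R) (n : nat) : R :=
  if n is n'.+1 then x * altprod y x n' else 1.

(* The Hecke algebra as the quotient of the terms in the generators T_s by    *)
(* the congruence generated by the axioms of an associative unital            *)
(* Z[q, q^-1]-algebra and the quadratic and braid relations. Generators are   *)
(* indexed by all of W for convenience, those outside S being killed.         *)

Inductive hterm (W : Type) : Type :=
| HScal of laurent
| HGen of W
| HAdd of hterm W & hterm W
| HMul of hterm W & hterm W.
Arguments HScal {W}.

Section Hecke.
Variables (W : groupType) (S : set W).

Local Notation term := (hterm W).

Fixpoint haltprod (x y : term) (n : nat) : term :=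
  if n is n'.+1 then HMul x (haltprod y x n') else HScal 1.

Inductive heqv : term -> term -> Prop :=
| heqv_refl x : heqv x x
| heqv_sym x y : heqv x y -> heqv y x
| heqv_trans y x z : heqv x y -> heqv y z -> heqv x z
| heqv_add x x' y y' : heqv x x' -> heqv y y' -> heqv (HAdd x y) (HAdd x' y')
| heqv_mul x x' y y' : heqv x x' -> heqv y y' -> heqv (HMul x y) (HMul x' y')
| heqv_addA x y z : heqv (HAdd x (HAdd y z)) (HAdd (HAdd x y) z)
| heqv_addC x y : heqv (HAdd x y) (HAdd y x)
| heqv_add0 x : heqv (HAdd (HScal 0) x) x
| heqv_mulA x y z : heqv (HMul x (HMul y z)) (HMul (HMul x y) z)
| heqv_mul1 x : heqv (HMul (HScal 1) x) x
| heqv_mulDl x y z : heqv (HMul (HAdd x y) z) (HAdd (HMul x z) (HMul y z))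
| heqv_mulDr x y z : heqv (HMul x (HAdd y z)) (HAdd (HMul x y) (HMul x z))
| heqv_scalD a b : heqv (HScal (a + b)) (HAdd (HScal a) (HScal b))
| heqv_scalM a b : heqv (HScal (a * b)) (HMul (HScal a) (HScal b))
| heqv_scalC a x : heqv (HMul (HScal a) x) (HMul x (HScal a))
| heqv_mul0 x : heqv (HMul (HScal 0) x) (HScal 0)
| heqv_out s : ~ S s -> heqv (HGen s) (HScal 0)
| heqv_quad s : S s -> heqv (HMul (HGen s) (HGen s))
    (HAdd (HScal 1) (HMul (HScal (lq - lqV)) (HGen s)))
| heqv_braid s t m : S s -> S t -> has_order (s * t)%g m ->
    heqv (haltprod (HGen s) (HGen t) m) (haltprod (HGen t) (HGen s) m).

HB.instance Definition _ := gen_eqMixin (hterm W).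
HB.instance Definition _ := gen_choiceMixin (hterm W).

Definition heqvb (x y : term) : bool := `[< heqv x y >].

Lemma heqvb_equiv : equiv_class_of heqvb.
Proof.
split=> [x|x y|y x z].
- exact/asboolP/heqv_refl.
- by apply/asboolP/asboolP => /heqv_sym.
- by move=> /asboolP xy /asboolP yz; apply/asboolP/(heqv_trans xy yz).
Qed.

Canonical heqv_equivrel := EquivRelPack heqvb_equiv.

Definition hecke : Type := {eq_quot heqvb}%qT.
HB.instance Definition _ := Choice.on hecke.
HB.instance Definition _ : EqQuotient _ heqvb hecke := EqQuotient.on hecke.

Definition hclass (x : term) : hecke := (\pi x)%qT.

Lemma hclassP x y : heqv x y <-> hclass x = hclass y.
Proof.
rewrite /hclass; split=> [xy|]; first by apply/eqmodP/asboolP.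
by move/eqmodP/asboolP.
Qed.

Lemma hclass_surj (P : hecke -> Prop) : (forall x, P (hclass x)) -> forall x, P x.
Proof. by move=> Px; elim/quotW. Qed.

Lemma hrepr_eqv x : heqv (repr (hclass x)) x.
Proof. by apply/hclassP; rewrite /hclass reprK. Qed.

Definition hadd (x y : hecke) := hclass (HAdd (repr x) (repr y)).
Definition hmul (x y : hecke) := hclass (HMul (repr x) (repr y)).
Definition hscal (a : laurent) : hecke := hclass (HScal a).
Definition hopp (x : hecke) := hmul (hscal (-1)) x.

Lemma hclassD x y : hadd (hclass x) (hclass y) = hclass (HAdd x y).
Proof. by apply/hclassP/heqv_add; apply: hrepr_eqv. Qed.

Lemma hclassM x y : hmul (hclass x) (hclass y) = hclass (HMul x y).
Proof. by apply/hclassP/heqv_mul; apply: hrepr_eqv. Qed.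

Let hE := (hclassD, hclassM).

Lemma haddA : associative hadd.
Proof.
by elim/hclass_surj=> x; elim/hclass_surj=> y; elim/hclass_surj=> z;
   rewrite !hE; apply/hclassP/heqv_addA.
Qed.

Lemma haddC : commutative hadd.
Proof.
by elim/hclass_surj=> x; elim/hclass_surj=> y; rewrite !hE;
   apply/hclassP/heqv_addC.
Qed.

Lemma hadd0 : left_id (hscal 0) hadd.
Proof. by elim/hclass_surj=> x; rewrite !hE; apply/hclassP/heqv_add0. Qed.

Lemma hmulA : associative hmul.
Proof.
by elim/hclass_surj=> x; elim/hclass_surj=> y; elim/hclass_surj=> z;
   rewrite !hE; apply/hclassP/heqv_mulA.
Qed.

Lemma hscalC a x : hmul (hscal a) x = hmul x (hscal a).
Proof.
by move: x; elim/hclass_surj=> x; rewrite !hE; apply/hclassP/heqv_scalC.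
Qed.

Lemma hmul1l : left_id (hscal 1) hmul.
Proof. by elim/hclass_surj=> x; rewrite !hE; apply/hclassP/heqv_mul1. Qed.

Lemma hmul1r : right_id (hscal 1) hmul.
Proof. by move=> x; rewrite -hscalC hmul1l. Qed.

Lemma hmulDl : left_distributive hmul hadd.
Proof.
by elim/hclass_surj=> x; elim/hclass_surj=> y; elim/hclass_surj=> z;
   rewrite !hE; apply/hclassP/heqv_mulDl.
Qed.

Lemma hmulDr : right_distributive hmul hadd.
Proof.
by elim/hclass_surj=> x; elim/hclass_surj=> y; elim/hclass_surj=> z;
   rewrite !hE; apply/hclassP/heqv_mulDr.
Qed.

Lemma hscalD a b : hadd (hscal a) (hscal b) = hscal (a + b).
Proof. by rewrite hE; apply/hclassP/heqv_sym/heqv_scalD. Qed.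

Lemma hscalM a b : hmul (hscal a) (hscal b) = hscal (a * b).
Proof. by rewrite hE; apply/hclassP/heqv_sym/heqv_scalM. Qed.

Lemma haddN : left_inverse (hscal 0) hopp hadd.
Proof.
move=> x; rewrite -{2}[x]hmul1l /hopp -hmulDl hscalD addNr.
by move: x; elim/hclass_surj=> x; rewrite hE; apply/hclassP/heqv_mul0.
Qed.

HB.instance Definition _ :=
  GRing.isZmodule.Build hecke haddA haddC hadd0 haddN.
HB.instance Definition _ :=
  GRing.Zmodule_isPzRing.Build hecke hmulA hmul1l hmul1r hmulDl hmulDr.

Lemma hscal_zmod_morphism : zmod_morphism hscal.
Proof.
move=> a b; rewrite -hscalD; congr hadd.
by rewrite -[- b]mulN1r -hscalM.
Qed.
HB.instance Definition _ :=
  GRing.isZmodMorphism.Build laurent hecke hscal hscal_zmod_morphism.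

Lemma hscal_monoid_morphism : monoid_morphism hscal.
Proof. by split=> // a b; rewrite -hscalM. Qed.
HB.instance Definition _ :=
  GRing.isMonoidMorphism.Build laurent hecke hscal hscal_monoid_morphism.

Definition hT (s : W) : hecke := hclass (HGen s).

Lemma hclass_alt x y n :
  hclass (haltprod x y n) = altprod (hclass x) (hclass y) n.
Proof. by elim: n x y => //= n IH x y; rewrite -IH -hclassM. Qed.

Lemma hT_out s : ~ S s -> hT s = 0.
Proof. by move=> Ss; apply/hclassP/heqv_out. Qed.

Lemma hT_quad_scal s : S s -> hT s * hT s = 1 + hscal (lq - lqV) * hT s.
Proof.
move=> /heqv_quad/hclassP; rewrite -hclassM -[in RHS]hclassD -[in RHS]hclassM.
exact.
Qed.

Lemma hT_braid s t m : S s -> S t -> has_order (s * t)%g m ->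
  altprod (hT s) (hT t) m = altprod (hT t) (hT s) m.
Proof.
by move=> Ss St stm; rewrite -!hclass_alt; apply/hclassP/heqv_braid.
Qed.

(* The universal property of the presentation, for algebras over Z[q, q^-1]   *)
(* given by a ring morphism with central image.                               *)
Section Lift.
Variables (B : pzRingType) (c : {rmorphism laurent -> B}) (f : W -> B).
Hypothesis c_central : forall a x, c a * x = x * c a.
Hypothesis f_out : forall s, ~ S s -> f s = 0.
Hypothesis f_quad : forall s, S s -> f s * f s = 1 + c (lq - lqV) * f s.
Hypothesis f_braid : forall s t m, S s -> S t -> has_order (s * t)%g m ->
  altprod (f s) (f t) m = altprod (f t) (f s) m.

Fixpoint heval (x : term) : B :=
  match x with
  | HScal a => c a
  | HGen s => f s
  | HAdd x y => heval x + heval y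
  | HMul x y => heval x * heval y
  end.

Lemma heval_alt x y n : heval (haltprod x y n) = altprod (heval x) (heval y) n.
Proof. by elim: n x y => [|n IH] x y /=; rewrite ?rmorph1 ?IH. Qed.

Lemma heval_eqv x y : heqv x y -> heval x = heval y.
Proof.
elim=> {x y} /=.
- by [].
- by move=> x y _ ->.
- by move=> y x z _ -> _ ->.
- by move=> x x' y y' _ -> _ ->.
- by move=> x x' y y' _ -> _ ->.
- by move=> x y z; rewrite addrA.
- by move=> x y; rewrite addrC.
- by move=> x; rewrite rmorph0 add0r.
- by move=> x y z; rewrite mulrA.
- by move=> x; rewrite rmorph1 mul1r.
- by move=> x y z; rewrite mulrDl.
- by move=> x y z; rewrite mulrDr.
- by move=> a b; rewrite rmorphD.
- by move=> a b; rewrite rmorphM.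
- by move=> a x; rewrite c_central.
- by move=> x; rewrite rmorph0 mul0r.
- by move=> s Ss; rewrite f_out// rmorph0.
- by move=> s Ss; rewrite f_quad// rmorph1.
- by move=> s t m Ss St stm; rewrite !heval_alt/=; exact: f_braid.
Qed.

Definition hlift (x : hecke) : B := heval (repr x).

Lemma hliftE x : hlift (hclass x) = heval x.
Proof. exact/heval_eqv/hrepr_eqv. Qed.

Lemma hlift_scal a : hlift (hscal a) = c a.
Proof. by rewrite hliftE. Qed.

Lemma hliftT s : hlift (hT s) = f s.
Proof. by rewrite hliftE. Qed.

Lemma hliftD x y : hlift (x + y) = hlift x + hlift y.
Proof.
move: x y; elim/hclass_surj=> x; elim/hclass_surj=> y.
by rewrite [_ + _]hclassD !hliftE.
Qed.

Lemma hliftM x y : hlift (x * y) = hlift x * hlift y.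
Proof.
move: x y; elim/hclass_surj=> x; elim/hclass_surj=> y.
by rewrite [_ * _]hclassM !hliftE.
Qed.

End Lift.

(* T_s |-> q is a representation, whence H is nontrivial. *)
Lemma hecke_nontrivial : (1 : hecke) != 0.
Proof.
apply/eqP => h10.
pose f s : laurent := if `[< S s >] then lq else 0.
have f_out s : ~ S s -> f s = 0 by move=> Ss; rewrite /f asboolF.
have fS s : S s -> f s = lq by move=> Ss; rewrite /f asboolT.
have f_quad s : S s -> f s * f s = 1 + idfun (lq - lqV) * f s.
  by move=> Ss; rewrite !fS//= mulrBl lqVK addrCA subrr addr0.
have f_braid s t m : S s -> S t -> has_order (s * t)%g m ->
    altprod (f s) (f t) m = altprod (f t) (f s) m.
  by move=> Ss St _; rewrite !fS.
have fl := hlift_scal (c := idfun) (fun a x => mulrC _ _) f_out f_quad f_braid.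
have := congr1 (hlift idfun f) h10; rewrite [1]/(hscal 1) [0]/(hscal 0) !fl/=.
by move/eqP; rewrite oner_eq0.
Qed.

HB.instance Definition _ := GRing.PzSemiRing_isNonZero.Build hecke hecke_nontrivial.

Definition hscale (a : laurent) (x : hecke) : hecke := hscal a * x.

Lemma hscaleA a b x : hscale a (hscale b x) = hscale (a * b) x.
Proof. by rewrite /hscale mulrA -rmorphM. Qed.
Lemma hscale1 : left_id 1 hscale.
Proof. by move=> x; rewrite /hscale rmorph1 mul1r. Qed.
Lemma hscaleDr : right_distributive hscale +%R.
Proof. by move=> a x y; rewrite /hscale mulrDr. Qed.
Lemma hscaleDl x : {morph hscale^~ x : a b / a + b}.
Proof. by move=> a b; rewrite /hscale rmorphD mulrDl. Qed.
HB.instance Definition _ :=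
  GRing.Zmodule_isLmodule.Build laurent hecke hscaleA hscale1 hscaleDr hscaleDl.

Lemma hscaleAl (a : laurent) (x y : hecke) : a *: (x * y) = a *: x * y.
Proof. by rewrite /GRing.scale/= /hscale mulrA. Qed.
HB.instance Definition _ :=
  GRing.Lmodule_isLalgebra.Build laurent hecke hscaleAl.

Lemma hscaleAr (a : laurent) (x y : hecke) : a *: (x * y) = x * (a *: y).
Proof.
by rewrite /GRing.scale/= /hscale !mulrA; congr (_ * _); exact: hscalC.
Qed.
HB.instance Definition _ :=
  GRing.Lalgebra_isAlgebra.Build laurent hecke hscaleAr.

Lemma hscalE a : hscal a = a%:A.
Proof. by rewrite /GRing.scale/= /hscale mulr1. Qed.

Lemma hT_quad s : S s -> hT s * hT s = 1 + (lq - lqV) *: hT s.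
Proof. exact: hT_quad_scal. Qed.

End Hecke.

Section AltprodInverse.
Variable R : pzRingType.
Implicit Types (x y : R) (n : nat).

Lemma altprodSr x y n :
  altprod x y n.+1 = altprod x y n * (if odd n then y else x).
Proof.
elim: n x y => [|n IH] x y; first by rewrite /= mulr1 mul1r.
by rewrite [LHS]/= -/(altprod y x n.+1) IH mulrA /=; case: odd.
Qed.

Lemma altprod_inv x y x' y' n : x * x' = 1 -> y * y' = 1 ->
  altprod x y n * (if odd n then altprod x' y' n else altprod y' x' n) = 1.
Proof.
move=> xx yy; elim: n => [|n IH]; first by rewrite /= mulr1.
rewrite altprodSr /=; case: (odd n) IH => /= IH.
  by rewrite -mulrA [y * _]mulrA yy mul1r.
by rewrite -mulrA [x * _]mulrA xx mul1r.
Qed.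

Lemma altprod_braid_inv x y x' y' n :
  x * x' = 1 -> x' * x = 1 -> y * y' = 1 -> y' * y = 1 ->
  altprod x y n = altprod y x n -> altprod x' y' n = altprod y' x' n.
Proof.
move=> xx xx' yy yy' xy.
have := altprod_inv n xx yy; have := altprod_inv n yy xx.
have := altprod_inv n xx' yy'; rewrite -xy if_same.
set P := altprod x y n; set Q := altprod x' y' n; set Q' := altprod y' x' n.
move=> QP H1 H2; have PQ' : P * Q' = 1 by case: odd H1 H2.
by rewrite -[Q]mulr1 -PQ' mulrA QP mul1r.
Qed.

End AltprodInverse.

Section HeckeBar.
Variables (W : groupType) (S : set W).
Local Notation H := (hecke S).
Local Notation T := (hT S).

Definition hTbar (s : W) : H := if `[< S s >] then T s - (lq - lqV)%:A else 0.

Definition hscalbar (a : laurent) : H := hscal S (lbar a).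
HB.instance Definition _ := GRing.RMorphism.on (hscal S \o lbar).
HB.instance Definition _ := GRing.RMorphism.copy hscalbar (hscal S \o lbar).

Lemma hT_inv s : S s -> T s * hTbar s = 1 /\ hTbar s * T s = 1.
Proof.
move=> Ss; rewrite /hTbar asboolT//; split.
  by rewrite mulrBr hT_quad// -scalerAr mulr1 addrK.
by rewrite mulrBl hT_quad// -scalerAl mul1r addrK.
Qed.

Lemma hscalbar_central a x : hscalbar a * x = x * hscalbar a.
Proof. exact: hscalC. Qed.

Lemma hTbar_out s : ~ S s -> hTbar s = 0.
Proof. by move=> Ss; rewrite /hTbar asboolF. Qed.

Lemma hTbar_quad s : S s ->
  hTbar s * hTbar s = 1 + hscalbar (lq - lqV) * hTbar s.
Proof.
move=> Ss; rewrite /hscalbar rmorphB/= lbarq lbarqV -opprB rmorphN/= hscalE.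
by have [TU _] := hT_inv Ss; rewrite {1}/hTbar asboolT// mulrBl TU mulNr.
Qed.

Lemma hTbar_braid s t m : S s -> S t -> has_order (s * t)%g m ->
  altprod (hTbar s) (hTbar t) m = altprod (hTbar t) (hTbar s) m.
Proof.
move=> Ss St stm; have [? ?] := hT_inv Ss; have [? ?] := hT_inv St.
by apply: (altprod_braid_inv (x := T s) (y := T t)) => //; exact: hT_braid.
Qed.

Definition hbar : H -> H := hlift hscalbar hTbar.

Lemma hbarD : {morph hbar : x y / x + y}.
Proof. by move=> x y; apply: (hliftD hscalbar_central hTbar_out hTbar_quad hTbar_braid). Qed.

Lemma hbarM : {morph hbar : x y / x * y}.
Proof. by move=> x y; apply: (hliftM hscalbar_central hTbar_out hTbar_quad hTbar_braid). Qed.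

Lemma hbar_scal a : hbar a%:A = (lbar a)%:A.
Proof. by rewrite -!hscalE; apply: (hlift_scal hscalbar_central hTbar_out hTbar_quad hTbar_braid). Qed.

Lemma hbar1 : hbar 1 = 1.
Proof. by have := hbar_scal 1; rewrite rmorph1 scale1r. Qed.

Lemma hbarT s : S s -> hbar (T s) = T s - (lq - lqV)%:A.
Proof.
move=> Ss; transitivity (hTbar s); last by rewrite /hTbar asboolT.
by apply: (hliftT hscalbar_central hTbar_out hTbar_quad hTbar_braid).
Qed.

Lemma hbarT_inv s : S s -> T s * hbar (T s) = 1 /\ hbar (T s) * T s = 1.
Proof.
by move=> Ss; rewrite hbarT//; have := hT_inv Ss; rewrite /hTbar asboolT.
Qed.

Lemma hbarK : involutive hbar.
Proof.
elim/hclass_surj; elim=> [a|s|x IHx y IHy|x IHx y IHy].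
- by rewrite -[hclass _ _]/(hscal S a) hscalE !hbar_scal lbarK.
- rewrite -[hclass _ _]/(T s); have [Ss|Ss] := pselect (S s); last first.
    rewrite hT_out//; have h0 : hbar 0 = 0.
      by have := hbar_scal 0; rewrite rmorph0 scale0r.
    by rewrite !h0.
  rewrite hbarT// hbarD hbarT// -scaleNr hbar_scal.
  rewrite (rmorphN lbar) (rmorphB lbar)/= lbarq lbarqV !opprB.
  by rewrite -addrA -scalerDl addrA subrK subrr scale0r addr0.
- have -> : hclass S (HAdd x y) = (hclass S x : H) + hclass S y.
    by rewrite -hclassD.
  by rewrite !hbarD IHx IHy.
- have -> : hclass S (HMul x y) = (hclass S x : H) * hclass S y.
    by rewrite -hclassM.
  by rewrite !hbarM IHx IHy.
Qed.

End HeckeBar.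

Section Coxeter.
Variables (W : groupType) (S : set W).
Local Open Scope group_scope.

Definition is_word (r : seq W) (w : W) : Prop :=
  {in r, forall s, S s} /\ \prod_(s <- r) s = w.

(* (W, S) is a Coxeter system: S is a generating set of involutions, and the  *)
(* relations (s t)^m = 1, for m the finite order of s t, present W.           *)
Definition coxeter_system : Prop :=
  [/\ forall s, S s -> has_order s 2,
      forall w, exists r, is_word r w &
      forall (G : groupType) (f : W -> G),
        (forall s t m, S s -> S t -> has_order (s * t) m ->
           (f s * f t) ^+ m = 1) ->
        exists phi : W -> G,
          {morph phi : x y / x * y} /\ forall s, S s -> phi s = f s].

(* The length function; the default 0 is not used when S generates W. *)
Definition len (w : W) : nat :=
  xget 0%N [set n | (exists2 r, is_word r w & size r = n) /\
                    forall r, is_word r w -> (n <= size r)%N].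

Definition reflection : set W := [set t | exists w s, S s /\ t = w * s * w^-1].

Definition bruhat_step (x y : W) : Prop :=
  (len x < len y)%N /\ exists2 t, reflection t & y = x * t.

Definition bruhat_le : W -> W -> Prop := clos_refl_trans W bruhat_step.
Definition bruhat_lt (x y : W) : Prop := bruhat_le x y /\ x <> y.

Definition left_weak (v w : W) : Prop := len w = (len (w * v^-1) + len v)%N.

Definition left_ideal (I : set W) : Prop :=
  I !=set0 /\ forall v w, left_weak v w -> I w -> I v.

Definition Pos (X : set W) : set W :=
  [set s | S s /\ forall x, X x -> (len x < len (x * s))%N].

(* The set D_J: minimal representatives of the cosets w W_J. *)
Definition coset_reps (J : set W) : set W :=
  [set w | forall s, J s -> (len w < len (w * s))%N].

Section Descents.
Variables (I J : set W).

Definition SD (w : W) : set W := [set s | S s /\ bruhat_lt (s * w) w].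
Definition SA (w : W) : set W :=
  [set s | [/\ S s, bruhat_lt w (s * w) & I (s * w)]].
Definition WD (w : W) : set W :=
  [set s | [/\ S s, bruhat_lt w (s * w) & ~ coset_reps J (s * w)]].
Definition WA (w : W) : set W :=
  [set s | [/\ S s, bruhat_lt w (s * w) & (coset_reps J `\` I) (s * w)]].
Definition Desc (w : W) : set W := SD w `|` WD w.
Definition Asc (w : W) : set W := SA w `|` WA w.

End Descents.
End Coxeter.

Section HeckeModules.
Variables (W : groupType) (S : set W).
Local Notation H := (hecke S).
Local Notation T := (hT S).

(* The Z[q, q^-1]-module structure underlying an H-module. *)
Definition ascale (M : lmodType H) (a : laurent) (m : M) : M := (a%:A : H) *: m.
Local Notation "a *' m" := (ascale a m) (at level 40, left associativity).

(* (b v)_{v in V} is a Z[q, q^-1]-basis of M: every m is a unique finite      *)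
(* linear combination. The values of b outside V are irrelevant.              *)
Definition is_basis (M : lmodType H) (U : choiceType) (V : set U) (b : U -> M)
    : Prop :=
  forall m : M, exists! a : U -> laurent,
    [/\ finite_set [set u | a u <> 0], [set u | a u <> 0] `<=` V &
        m = \sum_(u \in V) (a u *' b u)].

Section WGraphIdeal.
Variables (I J : set W).

Definition ideal_basis (M : lmodType H) (b : W -> M) : Prop :=
  is_basis I b /\
  forall s w, I w ->
  [/\ SA S I w s -> T s *: b w = b (s * w)%g,
      SD S w s -> T s *: b w = b (s * w)%g + (lq - lqV) *' b w,
      WD S J w s -> T s *: b w = - (lqV *' b w) &
      WA S I J w s -> exists r : W -> laurent,
        (forall y, I y -> bruhat_lt S y (s * w)%g -> lqZq (r y)) /\
        T s *: b w = lq *' b w -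
          \sum_(y \in [set y | I y /\ bruhat_lt S y (s * w)%g]) (r y *' b y)].

Definition ideal_bar (M : lmodType H) (b : W -> M) (bar : M -> M) : Prop :=
  [/\ {morph bar : x y / x + y},
      forall a x, bar (a *' x) = lbar a *' bar x,
      involutive bar,
      bar (b 1%g) = b 1%g &
      forall h x, bar (h *: x) = hbar h *: bar x].

Definition Wgraph_ideal : Prop :=
  exists (M : lmodType H) (b : W -> M),
    ideal_basis b /\ exists bar : M -> M, ideal_bar b bar.

End WGraphIdeal.

(* The data (V, mu, tau) of a W-graph. The vertex set V is a subset of an     *)
(* ambient type U; values of mu and tau outside V are irrelevant.             *)
Record graph_data (U : choiceType) := GraphData {
  gvert : set U;
  gmu : U -> U -> int;
  gtau : U -> set W }.

(* M is M_Gamma, b being the inclusion of the basis V. The defining sum must  *)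
(* have finitely many nonzero terms: \sum_(_ \in _) is 0 otherwise.           *)
Definition graph_module (U : choiceType) (Gamma : graph_data U)
    (M : lmodType H) (b : U -> M) : Prop :=
  is_basis (gvert Gamma) b /\
  forall s v, S s -> gvert Gamma v ->
    (gtau Gamma v s -> T s *: b v = - (lqV *' b v)) /\
    (~ gtau Gamma v s ->
       let N := [set u | gvert Gamma u /\ gtau Gamma u s] in
       finite_set [set u | N u /\ gmu Gamma u v <> 0] /\
       T s *: b v = lq *' b v + \sum_(u \in N) (b u *~ gmu Gamma u v)).

Definition is_Wgraph (U : choiceType) (Gamma : graph_data U) : Prop :=
  (forall v, gvert Gamma v -> gtau Gamma v `<=` S) /\
  exists (M : lmodType H) (b : U -> M), graph_module Gamma b.

Section Construction.
Variables (I J : set W).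

Definition valid_choice (ch : W -> W) : Prop :=
  forall z, I z -> z <> 1%g -> S (ch z) /\ (len S (ch z * z)%g < len S z)%N.

Section Mu.
Variable Q : W -> W -> {poly int}.

Definition muQ (y w : W) : int := (Q y w)`_0.

Definition sum_range (s y w : W) : set W :=
  [set x | [/\ I x, bruhat_lt S y x, bruhat_lt S x w & ~ Desc S J x s]].

(* The identities defining q_{y,z} := Q y z. They are stated in Z[q, q^-1],   *)
(* where q^-1 makes sense.                                                    *)
Definition construction (ch : W -> W) : Prop :=
  (forall y w, I y -> I w -> ~ bruhat_lt S y w -> Q y w = 0) /\
  forall z, I z -> z <> 1%g ->
    let s := ch z in
    let w := (s * z)%g in
    Q w z = 1 /\
    forall y, I y -> bruhat_lt S y z -> y <> w ->
    [/\ Asc S I J y s -> lpoly (Q y z) = lq * lpoly (Q y w),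
        SD S y s -> lpoly (Q y z) =
          - lqV * lpoly (Q y w - (muQ y w)%:P) + lpoly (Q (s * y)%g w) +
          \sum_(x \in sum_range s y w) ((muQ y x)%:~R * lpoly (Q x w)) &
        WD S J y s -> lpoly (Q y z) =
          - lqV * lpoly (Q y w - (muQ y w)%:P) +
          \sum_(x \in sum_range s y w) ((muQ y x)%:~R * lpoly (Q x w))].

(* The set C in bijection with I is taken to be I itself. *)
Definition graph_of : graph_data W :=
  {| gvert := I;
     gmu := fun y w => if `[< bruhat_lt S y w >] then muQ y w
                       else if `[< bruhat_lt S w y >] then muQ w y else 0;
     gtau := Desc S J |}.

Definition graph_formulas (M : lmodType H) (c : W -> M) : Prop :=
  forall s w, S s -> I w ->
    let R := [set y | [/\ I y, bruhat_lt S y w & Desc S J y s]] in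
    [/\ Desc S J w s -> T s *: c w = - (lqV *' c w),
        WA S I J w s -> T s *: c w = lq *' c w + \sum_(y \in R) (c y *~ muQ y w) &
        SA S I w s ->
          T s *: c w = lq *' c w + c (s * w)%g + \sum_(y \in R) (c y *~ muQ y w)].

End Mu.

Definition construction_produces_Wgraph : Prop :=
  exists (ch : W -> W) (Q : W -> W -> {poly int}),
    [/\ valid_choice ch, construction Q ch, is_Wgraph (graph_of Q) &
        forall (M : lmodType H) (c : W -> M),
          graph_module (graph_of Q) c -> graph_formulas Q c].

End Construction.
End HeckeModules.

(* Main.v *)
From HB Require Import structures.
From mathcomp Require Import all_boot all_order all_algebra.
From mathcomp Require Import finmap all_classical.
From mathcomp Require Import zify ring.
From Stdlib Require Import Relations.Relation_Operators Relations.Operators_Properties.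
Require Import Defs.

Set Implicit Arguments.
Unset Strict Implicit.
Unset Printing Implicit Defensive.

Import Order.TTheory GRing.Theory.

(** The module of a W-graph ideal and the module of the W-graph are one and the same
    module, seen in two bases: the basis b_w on which the T_s act as in a W-graph ideal, and
    the basis c_w of the vertices. They are related by the unitriangular change of basis
    [b_w = c_w + q sum_(y < w) q_(y,w) c_y], see [std_elt].

    The bridge is [recursionP]. If the T_s act on the c_w by the formulas of the theorem, then
    the equation T_s b_w = b_sw, for s with sw > w and sw in the ideal, written in the
    coordinates of the c_y, is the recursion that defines the polynomials q_(y,sw) from
    the q_(y,w). So the construction for given choices amounts to T_s b_sz = b_z for
    the chosen descents s.

    From the ideal to the graph one follows Kazhdan and Lusztig. By induction on the length
    there are bar-invariant elements c_w congruent to b_w modulo q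
    ([bar_invariant_exists]). As a bar-invariant element with coordinates in q Z[q] is
    zero ([bar_fixed_eq0]), equations between bar-invariant elements need only be checked
    modulo q, and this proves the formulas for T_s c_w ([formulas]). The recursion then holds
    for all choices of descents. In the graph the edge weights are symmetric; that no
    unwanted edges lead upwards is [kl_top_mu].

    From the graph to the ideal, the b_w are defined by the change of basis and the bar
    involution by fixing the c_w. The recursion shows b_w = T_w c_1 ([std_elt_hTw]), first
    along the chosen descents only; but T_w is the product along any reduced word
    ([Tprod_inj]), so that T_s b_w = b_sw for all strong ascents. If sw lies outside the
    minimal coset representatives then sw = wt with t in J ([deodhar]) and
    T_s b_w = T_w T_t c_1 = -q^-1 b_w. At a weak ascent (T_s - q) b_w vanishes modulo q by
    the same computation as in the other direction ([act_std_elt_lower]).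

    The facts on Coxeter groups that this takes, namely strong exchange, the lifting property
    of the Bruhat order and Matsumoto's theorem for the products T_w, are derived from the
    presentation by means of the cocycle that sends w to the set of its inversions
    ([left_inversion]). *)

(** * The inversion cocycle of a Coxeter group *)

Section InversionGroup.
Variable W : groupType.
Local Open Scope classical_set_scope.
Local Open Scope group_scope.

(** The semidirect product of W with the sets of elements of W, a set being given by its
    indicator function and W acting by conjugation. A morphism from W to this group that
    is the identity on the second factor is a cocycle with values in sets, and the
    universal property of the presentation makes it possible to prescribe it on S. *)
Definition inv_group : Type := ((W -> bool) * W)%type.

HB.instance Definition _ := gen_eqMixin inv_group.
HB.instance Definition _ := gen_choiceMixin inv_group.

Definition ig_one : inv_group := (fun=> false, 1).
Definition ig_inv (x : inv_group) : inv_group :=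
  (fun t => x.1 (t ^ x.2^-1), x.2^-1).
Definition ig_mul (x y : inv_group) : inv_group :=
  (fun t => x.1 t (+) y.1 (t ^ x.2), x.2 * y.2).

Lemma ig_mulA : associative ig_mul.
Proof.
move=> x y z; congr pair; rewrite /= ?mulgA//.
by apply/funext => t; rewrite addbA conjgM.
Qed.

Lemma ig_mul1g : left_id ig_one ig_mul.
Proof.
by move=> [f u]; congr pair => /=; rewrite ?mul1g//; apply/funext => t; rewrite conjg1.
Qed.

Lemma ig_mulg1 : right_id ig_one ig_mul.
Proof.
by move=> [f u]; congr pair => /=; rewrite ?mulg1//; apply/funext => t; rewrite addbF.
Qed.

Lemma ig_mulVg : left_inverse ig_one ig_inv ig_mul.
Proof.
by move=> [f u]; congr pair => /=; rewrite ?mulVg//; apply/funext => t; rewrite addbb.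
Qed.

Lemma ig_mulgV : right_inverse ig_one ig_inv ig_mul.
Proof.
move=> [f u]; congr pair => /=; rewrite ?mulgV//; apply/funext => t.
by rewrite conjgK addbb.
Qed.

HB.instance Definition _ := isGroup.Build inv_group
  ig_mulA ig_mul1g ig_mulg1 ig_mulVg ig_mulgV.

Lemma ig_mulE (x y : inv_group) : x * y = (fun t => x.1 t (+) y.1 (t ^ x.2), x.2 * y.2).
Proof. by []. Qed.

Lemma dihedral_swap (s t : W) n : s * s = 1 -> t * t = 1 ->
  s * (s * t) ^- n = (s * t) ^+ n * s.
Proof.
move=> ss tt.
have sV : s^-1 = s by apply: mulg1_eq.
have tV : t^-1 = t by apply: mulg1_eq.
elim: n => [|n IH]; first by rewrite !expg0 invg1 mulg1 mul1g.
by rewrite {1}expgSr !invgM sV tV [in RHS]expgS -[RHS]mulgA -IH !mulgA.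
Qed.

Definition ig_gen (s : W) : inv_group := (fun t => t == s, s).

(** The indicator on the right runs over the [2n] reflections [s, sts, ststs, ...]. When
    [st] has order [n] the second half of the list repeats the first, so that the sum
    vanishes: this is the relation that the universal property asks for. *)
Lemma ig_gen_exp (s t : W) n : s * s = 1 -> t * t = 1 ->
  (ig_gen s * ig_gen t) ^+ n =
  (fun r => \big[addb/false]_(j < n.*2) (r == (s * t) ^+ j * s), (s * t) ^+ n).
Proof.
move=> ss tt.
have sV : s^-1 = s by apply: mulg1_eq.
elim: n => [|n IH].
  by rewrite !expg0; congr pair; apply/funext => r; rewrite big_ord0.
rewrite expgSr IH !ig_mulE /= -expgSr; congr pair; apply/funext => r.
have H x y : (r ^ x == y) = (r == x * (y * x^-1)).
  by rewrite (can2_eq (conjgK x) (conjgKV x)) conjgE invgK.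
rewrite doubleS !big_ord_recr /= -addbA; congr (_ (+) (_ (+) _)).
  by rewrite H dihedral_swap// mulgA -expgnDr addnn.
rewrite -conjgM H invgM sV dihedral_swap// -addnn -addSn expgnDr expgSr.
by rewrite !mulgA.
Qed.

End InversionGroup.

Section CoxeterTheory.
Variables (W : groupType) (S : set W).
Hypothesis hWS : coxeter_system S.
Local Open Scope classical_set_scope.
Local Open Scope group_scope.
Local Notation len := (len S).

Lemma gen_sq s : S s -> s * s = 1.
Proof. by case: hWS => + _ _ => /[apply] -[_ + _]; rewrite expg2. Qed.

Lemma gen_neq1 s : S s -> s <> 1.
Proof. by case: hWS => + _ _ => /[apply] -[_ _] /(_ 1%N isT); rewrite expg1. Qed.

Lemma genV s : S s -> s^-1 = s.
Proof. by move=> Ss; apply: mulg1_eq; exact: gen_sq. Qed.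

Lemma genK s w : S s -> s * (s * w) = w.
Proof. by move=> Ss; rewrite mulgA gen_sq// mul1g. Qed.

Lemma inversions_exist : exists N : W -> W -> bool,
  (forall u v t, N (u * v) t = N u t (+) N v (t ^ u)) /\
  (forall s t, S s -> N s t = (t == s)).
Proof.
case: hWS => _ gen /(_ (inv_group W) (@ig_gen W)) [].
  move=> s t m Ss St [m0 stm _].
  rewrite ig_gen_exp ?gen_sq// stm; congr pair; apply/funext => r.
  rewrite -addnn big_split_ord /=.
  by under [X in _ (+) X]eq_bigr do rewrite expgnDr stm mul1g; rewrite addbb.
move=> phi [phiM phiS].
have phi2 w : (phi w).2 = w.
  have [r [rS <-]] := gen w; elim: r rS => [|s r IH] rS.
    rewrite big_nil; apply: (mulgI (phi 1).2).
    by rewrite -[LHS]/((phi 1 * phi 1).2) -phiM !mulg1.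
  rewrite big_cons phiM ig_mulE /= phiS ?IH//; last by apply: rS; rewrite inE eqxx.
  by move=> x xr; apply: rS; rewrite inE xr orbT.
exists (fun w => (phi w).1); split=> [u v t|s t Ss]; last by rewrite phiS.
by rewrite phiM /= phi2.
Qed.

(** The set N(w) of the reflections t such that tw is shorter than w, see
    [left_inversionE]. It is defined as a cocycle because the length is not accessible by
    algebra, whereas a cocycle can be computed on any word for w. *)
Definition left_inversion : W -> W -> bool := projT1 (cid inversions_exist).

Lemma left_inversionM u v t : left_inversion (u * v) t = left_inversion u t (+) left_inversion v (t ^ u).
Proof. by rewrite /left_inversion; case: cid => N []. Qed.

Lemma left_inversion_gen s t : S s -> left_inversion s t = (t == s).
Proof. by rewrite /left_inversion; case: cid => N [_] /= /[apply]. Qed.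

Lemma left_inversion1 t : left_inversion 1 t = false.
Proof. by have := left_inversionM 1 1 t; rewrite mulg1 conjg1 addbb. Qed.

Lemma left_inversionV w t : left_inversion w^-1 t = left_inversion w (t ^ w^-1).
Proof.
have := left_inversionM w w^-1 (t ^ w^-1); rewrite mulgV left_inversion1 conjgKV.
by case: (left_inversion _ _) (left_inversion _ _) => -[].
Qed.

(** Write t = u s u^-1. The contributions of u and of u^-1 to N(t) at t cancel, which
    leaves that of s. *)
Lemma left_inversion_refl t : reflection S t -> left_inversion t t.
Proof.
move=> [u [s [Ss tE]]]; have tu : t ^ u = s.
  by rewrite tE conjgE !mulgA mulVg mul1g mulgVK.
have su : s ^ u^-1 = t by rewrite -tu conjgK.
have ss : s ^ s = s by rewrite conjgE mulKg.
rewrite {1}tE !left_inversionM left_inversionV conjgM tu ss su (left_inversion_gen s Ss) eqxx.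
by case: (left_inversion _ _).
Qed.

(** * Length and strong exchange *)

Lemma lenP w : (exists2 r, is_word S r w & size r = len w) /\
  forall r, is_word S r w -> (len w <= size r)%N.
Proof.
have [_ gen _] := hWS; have [r0 wr0] := gen w.
have ex : exists n, `[< exists2 r, is_word S r w & size r = n >].
  by exists (size r0); apply/asboolP; exists r0.
have := @xgetPex _ 0%N [set n | (exists2 r, is_word S r w & size r = n) /\
  forall r, is_word S r w -> (n <= size r)%N]; apply.
case: (ex_minnP ex) => n /asboolP nr nmin; exists n; split=> //.
by move=> r wr; apply: nmin; apply/asboolP; exists r.
Qed.

Lemma len_word w : exists2 r, is_word S r w & size r = len w.
Proof. by have [] := lenP w. Qed.

Lemma len_min r w : is_word S r w -> (len w <= size r)%N.
Proof. by have [_] := lenP w; apply. Qed.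

Lemma is_word_nil : is_word S [::] 1.
Proof. by split; rewrite ?big_nil. Qed.

Lemma is_word_cons s r w : is_word S (s :: r) w <-> S s /\ is_word S r (s^-1 * w).
Proof.
split=> [[rS rw]|[Ss [rS rw]]].
  split; first by apply: rS; rewrite inE eqxx.
  split; first by move=> x xr; apply: rS; rewrite inE xr orbT.
  by rewrite -rw big_cons mulKg.
split; last by rewrite big_cons rw mulVKg.
by move=> x; rewrite inE => /predU1P[->//|/rS].
Qed.

Lemma is_word_cat r r' w w' :
  is_word S r w -> is_word S r' w' -> is_word S (r ++ r') (w * w').
Proof.
move=> [rS <-] [rS' <-]; split; last by rewrite big_cat.
by move=> x; rewrite mem_cat => /orP[/rS|/rS'].
Qed.

Lemma len1 : len 1 = 0%N.
Proof. by apply/eqP; rewrite -leqn0; exact: (len_min is_word_nil). Qed.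

Lemma len_eq0 w : len w = 0%N -> w = 1.
Proof.
move=> e; have [r [_ rw]] := len_word w.
by rewrite e => /size0nil r0; rewrite -rw r0 big_nil.
Qed.

Lemma len_mul u v : (len (u * v) <= len u + len v)%N.
Proof.
have [r ur <-] := len_word u; have [r' vr <-] := len_word v.
by rewrite -size_cat; apply/len_min/is_word_cat.
Qed.

Lemma len_gen_le s : S s -> (len s <= 1)%N.
Proof. by move=> Ss; apply: (@len_min [:: s]); split; rewrite ?big_seq1// => x /[!inE] /eqP->. Qed.

(** The strong exchange condition: along a reduced word of w, the first letter that
    contributes t to N(w) can be deleted to give a word for tw. *)
Lemma left_inversion_len w t : left_inversion w t -> (len (t * w) < len w)%N.
Proof.
have [r rw <-] := len_word w; elim: r w t rw => [|s r IH] w t.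
  by move=> [_ <-]; rewrite big_nil left_inversion1.
move=> /is_word_cons[Ss rw]; rewrite -(mulVKg s w); move: (s^-1 * w) rw => {}w rw.
rewrite left_inversionM left_inversion_gen//; have [-> _|_ /= Nw] := eqVneq t s.
  by rewrite genK//= ltnS len_min.
have {IH Nw} := IH _ _ rw Nw.
have -> : t * (s * w) = s * (t ^ s * w) by rewrite conjgE !mulgA mulgV mul1g.
move=> h; rewrite /= ltnS (leq_trans (len_mul _ _))//.
by rewrite -(add1n (len _)) in h; rewrite (leq_trans _ h)// leq_add2r len_gen_le.
Qed.

Lemma reflection_sq t : reflection S t -> t * t = 1.
Proof.
by move=> [u [s [Ss ->]]]; rewrite !mulgA mulgVK -(mulgA u) gen_sq// mulg1 mulgV.
Qed.

Lemma reflectionV t : reflection S t -> t^-1 = t.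
Proof. by move=> /reflection_sq/mulg1_eq. Qed.

Lemma reflection_gen s : S s -> reflection S s.
Proof. by move=> Ss; exists 1, s; rewrite mul1g invg1 mulg1. Qed.

Lemma reflectionJ t w : reflection S t -> reflection S (t ^ w).
Proof.
move=> [u [s [Ss ->]]]; exists (w^-1 * u), s; split=> //.
by rewrite conjgE invgM invgK !mulgA.
Qed.

(** N(tw) and N(w) differ at t, because N(t) contains t; hence exactly one of w and tw has
    t in its set of inversions, and strong exchange applies to that one. *)
Lemma left_inversionE w t : reflection S t -> left_inversion w t = (len (t * w) < len w)%N.
Proof.
move=> tR; apply/idP/idP; first exact: left_inversion_len.
apply: contraTT => Nw; rewrite -leqNgt ltnW//.
rewrite -{1}(mulKg t w) (reflectionV tR); apply: left_inversion_len.
by rewrite left_inversionM left_inversion_refl// conjgE mulKg (negbTE Nw).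
Qed.

Lemma len_refl w t : reflection S t -> ~~ (len (t * w) < len w)%N -> (len w < len (t * w))%N.
Proof.
move=> tR; rewrite -!left_inversionE// => Nw.
rewrite -{1}(mulKg t w) (reflectionV tR) -left_inversionE//.
by rewrite left_inversionM left_inversion_refl// conjgE mulKg (negbTE Nw).
Qed.

Lemma len_genl s w : S s ->
  if (len (s * w) < len w)%N then len w = (len (s * w)).+1 else len (s * w) = (len w).+1.
Proof.
move=> Ss; have sR := reflection_gen Ss.
have le1 u : (len (s * u) <= (len u).+1)%N.
  by rewrite (leq_trans (len_mul _ _))// -add1n leq_add2r len_gen_le.
case: ifP => [lt|/negbT/(len_refl sR) lt]; apply/eqP; rewrite eqn_leq lt ?le1//.
by rewrite andbT -{1}(genK w Ss).
Qed.

Lemma lenV w : len w^-1 = len w.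
Proof.
suff le u : (len u^-1 <= len u)%N by apply/eqP; rewrite eqn_leq le -{1}(invgK w) le.
have [r ru <-] := len_word u; rewrite -(size_rev r); apply: len_min.
elim: r u ru => [|s r IH] u; first by case=> _ <-; rewrite big_nil invg1; exact: is_word_nil.
move=> /is_word_cons[Ss /IH ru]; rewrite rev_cons -cats1.
have -> : u^-1 = (s^-1 * u)^-1 * s^-1 by rewrite invgM mulgVK.
by apply: is_word_cat => //; apply/is_word_cons; rewrite genV// gen_sq//; split=> //; exact: is_word_nil.
Qed.

Lemma len_genr s w : S s ->
  if (len (w * s) < len w)%N then len w = (len (w * s)).+1 else len (w * s) = (len w).+1.
Proof.
move=> Ss; have -> : len (w * s) = len (s * w^-1) by rewrite -(lenV (w * s)) invgM (genV Ss).
by rewrite -(lenV w); exact: len_genl.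
Qed.

Lemma descent_exists w : w <> 1 -> exists2 s, S s & (len (s * w) < len w)%N.
Proof.
move=> w1; have [[|s r] rw e] := len_word w.
  by case: w1; apply: len_eq0; rewrite -e.
have [Ss sr] := (is_word_cons _ _ _).1 rw; exists s => //.
by rewrite -e /= ltnS -{1}(genV Ss); exact: len_min.
Qed.

Lemma len_ind (P : W -> Prop) :
  (forall w, (forall v, (len v < len w)%N -> P v) -> P w) -> forall w, P w.
Proof.
move=> IH w; have [n] := ubnP (len w); elim: n w => // n IHn w; rewrite ltnS => wn.
by apply: IH => v vw; apply: IHn; exact: leq_trans wn.
Qed.

(** * The Bruhat order *)

Local Notation ble := (bruhat_le S).
Local Notation blt := (bruhat_lt S).

Lemma ble_refl x : ble x x. Proof. exact: rt_refl. Qed.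
Lemma ble_trans y x z : ble x y -> ble y z -> ble x z.
Proof. exact: rt_trans. Qed.

Lemma ble_len x y : ble x y -> x = y \/ (len x < len y)%N.
Proof.
elim=> [u v [uv _]|u|u v z _ [->|uv] _ [<-|vz]]; try by [left|right].
by right; exact: ltn_trans vz.
Qed.

Lemma blt_len x y : blt x y -> (len x < len y)%N.
Proof. by move=> [/ble_len[]]. Qed.

Lemma blt_irr x : ~ blt x x.
Proof. by move=> /blt_len; rewrite ltnn. Qed.

Lemma ble_ltP x y : ble x y -> (len x < len y)%N -> blt x y.
Proof. by move=> xy l; split=> // e; rewrite e ltnn in l. Qed.

Lemma ble_lt_trans y x z : ble x y -> blt y z -> blt x z.
Proof.
move=> xy yz; apply: ble_ltP; first exact: ble_trans yz.1.
by have [->|xy'] := ble_len xy; [|apply: (ltn_trans xy')]; exact: blt_len.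
Qed.

Lemma blt_le_trans y x z : blt x y -> ble y z -> blt x z.
Proof.
move=> xy yz; apply: ble_ltP; first exact: ble_trans xy.1 yz.
by have [<-|yz'] := ble_len yz; [|apply: (ltn_trans _ yz')]; exact: blt_len.
Qed.

Lemma blt_trans y x z : blt x y -> blt y z -> blt x z.
Proof. by move=> xy [yz _]; exact: blt_le_trans yz. Qed.

Lemma bruhat_stepE x y : bruhat_step S x y <->
  exists t, [/\ reflection S t, y = t * x & (len x < len (t * x))%N].
Proof.
split=> [[l [t tR yE]]|[t [tR -> l]]]; last first.
  split=> //; exists (t ^ x); first exact: reflectionJ.
  by rewrite conjgE mulVKg.
have yE' : y = t ^ x^-1 * x by rewrite yE conjgE invgK mulgA mulgVK.
by exists (t ^ x^-1); split=> //; [exact: reflectionJ|rewrite -yE'].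
Qed.

Lemma blt_genP s w : S s -> blt w (s * w) <-> (len w < len (s * w))%N.
Proof.
move=> Ss; split; first exact: blt_len.
move=> l; apply: ble_ltP => //; apply: rt_step; apply/bruhat_stepE; exists s.
by split=> //; exact: reflection_gen.
Qed.

Lemma blt_gen_descP s w : S s -> blt (s * w) w <-> (len (s * w) < len w)%N.
Proof. by move=> Ss; have := blt_genP (s * w) Ss; rewrite genK. Qed.

Lemma blt_gen_asc s w : S s -> ~ blt (s * w) w -> blt w (s * w).
Proof.
move=> Ss h; apply/blt_genP => //; apply: (len_refl (reflection_gen Ss)).
by apply/negP => /(blt_gen_descP _ Ss).
Qed.

(** Left multiplication by s carries the step from x to tx to the step from sx to
    (sts)(sx). It still goes up, because N(sx) contains sts only if N(x) contains t or
    sts = s. *)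
Lemma step_gen s t x : S s -> reflection S t -> t <> s -> (len x < len (t * x))%N ->
  bruhat_step S (s * x) (s * (t * x)).
Proof.
move=> Ss tR ts l; apply/bruhat_stepE; exists (t ^ s).
have e : t ^ s * (s * x) = s * (t * x) by rewrite conjgE genV// -!mulgA genK.
split=> //; first exact: reflectionJ.
apply: len_refl; first exact: reflectionJ.
rewrite -left_inversionE; last exact: reflectionJ.
rewrite left_inversionM left_inversion_gen// -conjgM gen_sq// conjg1.
have -> : (t ^ s == s) = false.
  by apply/eqP => h; apply: ts; apply: (@conjg_inj _ s); rewrite h conjgE mulKg.
by rewrite left_inversionE// -leqNgt ltnW.
Qed.

(** Together with [lift_down] this is the lifting property of the Bruhat order. The two
    inductions run along a chain from x to y from opposite ends: [step_gen] moves a single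
    step, and fails only for the step by s itself, where the claim is immediate. *)
Lemma lift_up s x y : S s -> ble x y -> ble (s * x) y \/ ble (s * x) (s * y).
Proof.
move=> Ss xy; have := @clos_rt_rt1n _ _ _ _ xy; elim=> {x y xy} [x|x z y]; first by right; exact: ble_refl.
move=> /bruhat_stepE[t [tR -> l]] zy0 IH; have zy := @clos_rt1n_rt _ _ _ _ zy0.
have [ts|ts] := pselect (t = s); first by left; rewrite -ts.
have st : ble (s * x) (s * (t * x)) by apply: rt_step; exact: step_gen.
by case: IH => h; [left|right]; exact: ble_trans h.
Qed.

Lemma lift_down s x y : S s -> ble x y -> (len (s * y) < len y)%N ->
  ble x (s * y) \/ ble (s * x) (s * y).
Proof.
move=> Ss xy; have := @clos_rt_rtn1 _ _ _ _ xy; elim=> {y xy} [|z y]; first by right; exact: ble_refl.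
move=> /bruhat_stepE[t [tR -> l]] xz0 IH; have xz := @clos_rtn1_rt _ _ _ _ xz0.
have [-> _|ts _] := pselect (t = s); first by rewrite genK//; left.
have st : ble (s * z) (s * (t * z)) by apply: rt_step; exact: step_gen.
have [zd|zd] := pselect (blt (s * z) z).
  by case: (IH (blt_len zd)) => h; [left|right]; exact: ble_trans st.
left; apply: ble_trans xz _; apply: ble_trans st.
by have [] := blt_gen_asc Ss zd.
Qed.

Lemma blt_mul_asc s y w : S s -> blt y w -> blt w (s * w) -> blt (s * y) (s * w).
Proof.
move=> Ss yw wsw; have [] := lift_up Ss yw.1 => h; first exact: ble_lt_trans wsw.
by split=> // /mulgI e; rewrite e in yw; exact: blt_irr yw.
Qed.

(** By the lifting property the elements below w lie in the union of those below sw and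
    their translates by s. Finiteness matters because sums over sets without finite
    support are zero by convention. *)
Lemma finite_ble w : finite_set [set x | ble x w].
Proof.
elim/len_ind: w => w IH.
have [->|w1] := pselect (w = 1).
  apply: (@sub_finite_set _ _ [set 1]); last exact: finite_set1.
  by move=> x /= /ble_len[//|]; rewrite len1.
have [s Ss l] := descent_exists w1.
have fin : finite_set [set x | ble x (s * w)] by apply: IH.
apply: (@sub_finite_set _ _ ([set x | ble x (s * w)] `|`
  (fun x => s * x) @` [set x | ble x (s * w)])).
  move=> x /= xw; have [] := lift_down Ss xw l => h; [by left|right].
  by exists (s * x); rewrite ?genK.
by rewrite finite_setU; split=> //; exact: finite_image.
Qed.

Lemma finite_blt w : finite_set [set x | blt x w].
Proof. by apply: sub_finite_set (finite_ble w) => x []. Qed.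

(** * Cosets, pairs of descents, and the elements T_w *)

(** Deodhar's alternative for cosets: if w is minimal in its coset but sw is not, then sw
    still lies in the coset of w. Indeed s becomes an inversion of wt without being one of w, so
    that it must be the reflection w t w^-1. *)
Lemma deodhar s t w : S s -> S t -> (len w < len (s * w))%N ->
  (len w < len (w * t))%N -> ~ (len (s * w) < len (s * w * t))%N -> s * w = w * t.
Proof.
move=> Ss St lsw lwt nl.
have sR := reflection_gen Ss; have tR := reflection_gen St.
have e : t ^ (s * w)^-1 * (s * w) = s * w * t by rewrite conjgE invgK -mulgA mulgVK.
have l : (len (s * w * t) < len (s * w))%N.
  apply: contra_notT nl; rewrite -e; apply: len_refl; exact: reflectionJ.
have Ns : left_inversion (w * t) s.
  rewrite left_inversionE// mulgA.
  have := len_genr (s * w) St; rewrite l => e1.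
  have := len_genl w Ss; rewrite ltnNge ltnW//= => e2.
  by move: e1; rewrite e2 => -[<-].
move: Ns; rewrite left_inversionM (left_inversionE _ sR) ltnNge ltnW//= left_inversion_gen// => /eqP <-.
by rewrite -conjgC.
Qed.

Fixpoint alternating (x y : W) n : W := if n is n'.+1 then x * alternating y x n' else 1.

Lemma expg_shift (s t : W) n : s * (t * s) ^+ n = (s * t) ^+ n * s.
Proof.
elim: n => [|n IH]; first by rewrite !expg0 mulg1 mul1g.
by rewrite expgSr mulgA IH expgSr !mulgA.
Qed.

Lemma left_inversion_alternating s t n r : S s -> S t -> left_inversion (alternating s t n) r ->
  exists2 j, (j < n)%N & r = (s * t) ^+ j * s.
Proof.
elim: n s t r => [|n IH] s t r Ss St /=; first by rewrite left_inversion1.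
rewrite left_inversionM left_inversion_gen//; have [-> _|_ /= /IH[]// j jn e] := eqVneq r s.
  by exists 0%N; rewrite // expg0 mul1g.
exists j.+1 => //; rewrite -(conjgK s r) e conjgE invgK genV//.
by rewrite mulgA mulgA expg_shift expgSr !mulgA.
Qed.

Lemma alternating_swap s t m : S s -> S t -> alternating s t m = (s * t) ^+ m * alternating t s m.
Proof.
elim: m s t => [|m IH] s t Ss St; first by rewrite expg0 mulg1.
by rewrite /= IH// mulgA expg_shift expgSr -!mulgA genK.
Qed.

(** If y is a descent of w but not an inversion of the alternating prefix of w, then strong
    exchange deletes a letter behind that prefix. Moving y in front lengthens the prefix by
    one letter. That y were an inversion of the prefix would make a small power of xy
    trivial. *)
Lemma alternating_step x y k v w : S x -> S y -> w = alternating x y k * v ->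
  len w = (k + len v)%N -> (len (y * w) < len w)%N ->
  (forall j, (0 < j <= k)%N -> (x * y) ^+ j <> 1) ->
  exists v', w = alternating y x k.+1 * v' /\ len w = (k.+1 + len v')%N.
Proof.
move=> Sx Sy wE lw lyw noord; have yR := reflection_gen Sy.
move: lyw; rewrite -(left_inversionE _ yR) {1}wE left_inversionM; set z := alternating x y k.
have -> : left_inversion z y = false.
  apply/negP => /(left_inversion_alternating Sx Sy)[j jk yE]; apply: (noord j.+1); first by lia.
  by rewrite expgSr mulgA -yE gen_sq.
rewrite /= (left_inversionE _ (reflectionJ _ yR)) => lv; exists (y ^ z * v).
have e : y * (z * (y ^ z * v)) = w by rewrite wE conjgE -!mulgA mulVKg genK.
have lz i (a b : W) : S a -> S b -> (len (alternating a b i) <= i)%N.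
  elim: i a b => [|i IH] a b Sa Sb /=; first by rewrite len1.
  by apply: leq_trans (len_mul _ _) _; rewrite -add1n leq_add ?len_gen_le ?IH.
have e' : w = alternating y x k.+1 * (y ^ z * v) by rewrite /= -/z -mulgA e.
split=> //; apply/eqP; rewrite eqn_leq; apply/andP; split.
  by rewrite {1}e'; apply: leq_trans (len_mul _ _) _; rewrite leq_add2r lz.
by rewrite lw addSnnS leq_add2l.
Qed.

Lemma alternating_factor k s t w : S s -> S t ->
  (len (s * w) < len w)%N -> (len (t * w) < len w)%N ->
  (forall j, (0 < j < k)%N -> (s * t) ^+ j <> 1) ->
  exists v, w = alternating s t k * v /\ len w = (k + len v)%N.
Proof.
elim: k s t => [|k IH] s t Ss St lsw ltw noord; first by exists w; rewrite mul1g.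
have noord' j : (0 < j <= k)%N -> (t * s) ^+ j <> 1.
  move=> jk e; apply: (noord j) => //.
  by rewrite -(genV Ss) -(genV St) -invgM expVgn e invg1.
have [v [wE lw]] := IH t s St Ss ltw lsw (fun j jk => noord' j ltac:(lia)).
exact: alternating_step wE lw lsw noord'.
Qed.

(** The prefix can be lengthened as long as no power of st is trivial, which bounds the
    order of st by the length of w. At that order the two alternating words coincide, so
    that both factorizations of w have the same second factor. *)
Lemma dihedral_descents s t w : S s -> S t ->
  (len (s * w) < len w)%N -> (len (t * w) < len w)%N ->
  exists m v, [/\ has_order (s * t) m, w = alternating s t m * v, w = alternating t s m * v &
    len w = (m + len v)%N].
Proof.
move=> Ss St lsw ltw.
have ex : exists m, (0 < m)%N && ((s * t) ^+ m == 1).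
  have [//|none] := pselect (exists m, (0 < m)%N && ((s * t) ^+ m == 1)).
  have [|v [_ lw]] := @alternating_factor (len w).+1 s t w Ss St lsw ltw; last by lia.
  by move=> j /andP[j0 _] e; apply: none; exists j; rewrite j0 e eqxx.
case: (ex_minnP ex) => m /andP[m0 /eqP stm] mmin.
have noord k : (0 < k < m)%N -> (s * t) ^+ k <> 1.
  move=> /andP[k0 km] e; have := mmin k; rewrite k0 e eqxx => /(_ isT).
  by rewrite leqNgt km.
have [v [wE lw]] := alternating_factor Ss St lsw ltw noord.
by exists m, v; split=> //; rewrite wE alternating_swap// stm mul1g.
Qed.

Local Notation T := (hT S).
Local Open Scope ring_scope.

(** T_w as a relation: the product of the generators along some reduced word of w. The
    content of Matsumoto's theorem is that it is functional, [Tprod_inj]. *)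
Inductive Tprod : W -> hecke S -> Prop :=
| Tprod1 : Tprod 1%g 1
| TprodS s w h : S s -> (len w < len (s * w)%g)%N -> Tprod w h ->
    Tprod (s * w)%g (T s * h).

Lemma Tprod_exists w : exists h, Tprod w h.
Proof.
elim/len_ind: w => w IH.
have [->|w1] := pselect (w = 1%g); first by exists 1; constructor.
have [s Ss l] := descent_exists w1; have [h wh] := IH (s * w)%g l.
by exists (T s * h); rewrite -{1}(genK w Ss); apply: TprodS; rewrite ?genK.
Qed.

Lemma Tprod_alternating s t n v g : S s -> S t -> Tprod v g ->
  len (alternating s t n * v)%g = (n + len v)%N ->
  Tprod (alternating s t n * v)%g (altprod (T s) (T t) n * g).
Proof.
move=> Ss St vg.
have le k (a b : W) : S a -> S b -> (len (alternating a b k * v)%g <= k + len v)%N.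
  elim: k a b => [|k IH] a b Sa Sb /=; first by rewrite mul1g.
  rewrite -mulgA; apply: leq_trans (len_mul _ _) _.
  by rewrite addSn -add1n leq_add ?len_gen_le ?IH.
elim: n s t Ss St => [|n IH] s t Ss St /= l; first by rewrite mul1g mul1r.
have len_n : len (alternating t s n * v)%g = (n + len v)%N.
  apply/eqP; rewrite eqn_leq le//= -ltnS -addSn -l -mulgA.
  by apply: leq_trans (len_mul _ _) _; rewrite -add1n leq_add2r len_gen_le.
rewrite -mulgA -mulrA; apply: TprodS => //; last exact: IH.
by rewrite mulgA l len_n.
Qed.

(** Let two reduced words of w start with s and t. If s = t, then the tails are reduced words of
    the same shorter element. Otherwise w also has reduced words starting with the two
    alternating words in s and t; the induction hypothesis at sw and at tw reduces the
    claim to the braid relation between these. *)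
Lemma Tprod_inj w h h' : Tprod w h -> Tprod w h' -> h = h'.
Proof.
elim/len_ind: w h h' => w IH h h'.
have inv u g : Tprod u g -> u = 1%g /\ g = 1 \/ exists s v k,
    [/\ S s, (len v < len u)%N, Tprod v k, u = (s * v)%g & g = T s * k].
  by case=> [|s v k Ss l vk]; [left|right; exists s, v, k].
move=> /inv[[-> ->]|[s [v [k [Ss lv vk wE ->]]]]].
  by move=> /inv[[]//|[s [v [k [_ + _ _ _]]]]]; rewrite len1.
move=> /inv[[w1 _]|[t [v' [k' [St lv' vk' wE' ->]]]]].
  by move: lv; rewrite w1 len1.
have [st|st] := pselect (s = t).
  have e : v = v' by apply: (@mulgI _ s); rewrite -wE st -wE'.
  by rewrite st; congr (_ * _); apply: (IH v) => //; rewrite e.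
have vE : (s * w)%g = v by rewrite wE genK.
have vE' : (t * w)%g = v' by rewrite wE' genK.
have lsw : (len (s * w)%g < len w)%N by rewrite vE.
have ltw : (len (t * w)%g < len w)%N by rewrite vE'.
have [m [u [stm wst wts lw]]] := dihedral_descents Ss St lsw ltw.
have [g ug] := Tprod_exists u.
case: m stm wst wts lw => [[]//|n] stm wst wts lw.
(* A word starting with [a] may be replaced by the one with an alternating prefix. *)
have key a b : S a -> S b -> w = (alternating a b n.+1 * u)%g -> (len (a * w)%g < len w)%N ->
    forall r, Tprod (a * w)%g r -> T a * r = altprod (T a) (T b) n.+1 * g.
  move=> Sa Sb wab law r awr /=; rewrite -mulrA; congr (_ * _).
  have awE : (a * w)%g = (alternating b a n * u)%g by rewrite wab /= -mulgA genK.
  apply: (IH (a * w)%g) => //.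
  rewrite awE; apply: Tprod_alternating => //; rewrite -awE.
  by have := len_genl w Sa; rewrite law lw addSn => -[].
rewrite (key s t)// ?vE// [RHS](key t s)// ?vE'//.
by congr (_ * _); exact: hT_braid.
Qed.

Definition hTw (w : W) : hecke S := projT1 (cid (Tprod_exists w)).

Lemma hTwP w : Tprod w (hTw w).
Proof. by rewrite /hTw; case: cid. Qed.

Lemma hTw1 : hTw 1%g = 1.
Proof. by apply: Tprod_inj (hTwP _) _; constructor. Qed.

Lemma hTw_mull s w : S s -> (len w < len (s * w)%g)%N -> hTw (s * w)%g = T s * hTw w.
Proof. by move=> Ss l; apply: Tprod_inj (hTwP _) _; constructor=> //; exact: hTwP. Qed.

(** T_w is built by left multiplications. By induction it is multiplicative on the right as
    well, since a left descent of w remains one of wt when wt is longer than w. *)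
Lemma hTw_mulr w t : S t -> (len w < len (w * t)%g)%N -> hTw (w * t)%g = hTw w * T t.
Proof.
move=> St; elim/len_ind: w => w IH l.
have [->|w1] := pselect (w = 1%g).
  by rewrite mul1g hTw1 mul1r -[X in hTw X]mulg1 hTw_mull ?hTw1 ?mulr1 // mulg1 len1 lt0n;
     apply/eqP => /len_eq0; exact: gen_neq1.
have [s Ss ls] := descent_exists w1.
have := len_genl w Ss; rewrite ls => e1.
have := len_genr w St; rewrite ltnNge (ltnW l)/= => e2.
have e3 := len_genr (s * w)%g St.
have e4 := len_genl (w * t)%g Ss; rewrite mulgA in e4.
have l1 : (len (s * w)%g < len (s * w * t)%g)%N.
  by move: e4; rewrite e2 e1; case: ifP e3 => _ ->; case: ifP => _; move: (len _) => n; lia.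
have e5 : len (s * w * t)%g = len w by move: e3; rewrite ltnNge (ltnW l1)/= => ->.
rewrite -{1}(genK w Ss) -(mulgA s) hTw_mull//; last first.
  by rewrite e5 -mulgA genK// e2.
rewrite IH//.
by rewrite mulrA -hTw_mull ?genK.
Qed.

End CoxeterTheory.

(** * Laurent polynomials *)

Section Laurent.
Local Open Scope classical_set_scope.
Local Open Scope ring_scope.
Implicit Types (a b : laurent) (p r : {poly int}).

Definition polyA : set laurent := range lpoly.

(** Closure without a unit: coefficients are taken not only in Z[q] and in all of
    Z[q, q^-1] but also in the ideal q Z[q]. *)
Definition nu_subring (P : set laurent) : Prop :=
  [/\ P 0, forall a b, P a -> P b -> P (a - b) & forall a b, P a -> P b -> P (a * b)].

Lemma nu_subringT : nu_subring setT. Proof. by []. Qed.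

Lemma nu_subring_polyA : nu_subring polyA.
Proof.
split=> [|_ _ [p _ <-] [r _ <-]|_ _ [p _ <-] [r _ <-]].
- by exists 0; rewrite ?rmorph0.
- by exists (p - r); rewrite ?rmorphB.
- by exists (p * r); rewrite ?rmorphM.
Qed.

Lemma nu_subring_lqZq : nu_subring lqZq.
Proof.
split=> [|_ _ [p _ <-] [r _ <-]|_ _ [p _ <-] [r _ <-]].
- by exists 0; rewrite ?rmorph0 ?mulr0.
- by exists (p - r); rewrite ?rmorphB ?mulrBr.
- by exists (p * 'X * r) => //; rewrite !rmorphM /= -/lq; ring.
Qed.

Lemma polyA_lpoly p : polyA (lpoly p). Proof. by exists p. Qed.
Lemma lqZq_lpoly p : lqZq (lq * lpoly p). Proof. by exists p. Qed.

Lemma lqZqM a b : lqZq a -> polyA b -> lqZq (a * b).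
Proof. by move=> [p _ <-] [r _ <-]; exists (p * r); rewrite ?rmorphM ?mulrA. Qed.

Lemma lqZq_lpolyX p : lqZq (lpoly (p - (p`_0)%:P)).
Proof.
exists (\poly_(i < size p) p`_i.+1) => //; rewrite -rmorphM; congr lpoly.
apply/polyP => i; rewrite coefXM coefB coefC coef_poly.
case: i => [|i]; rewrite /= ?subrr// subr0; case: ltnP => // h.
by rewrite nth_default// ltnW.
Qed.

Lemma lqI : injective ( *%R lq).
Proof. by move=> a b /(congr1 ( *%R lqV)); rewrite !mulrA lqVK !mul1r. Qed.

(** After multiplication by q this is the factor q^2 + 1, which is nonzero in the field of
    fractions. *)
Lemma lqDlqVI a : (lq + lqV) * a = 0 -> a = 0.
Proof.
move=> h; have {}h : lpoly ('X^2 + 1) * a = 0.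
  by rewrite rmorphD rmorphXn rmorph1 /= -/lq -lqKV expr2 -mulrDr -mulrA h mulr0.
apply: val_inj; have /eqP := congr1 val h.
rewrite /= mulf_eq0 tofrac_eq0 => /orP[|/eqP//].
by rewrite -size_poly_eq0 size_addl size_polyXn // size_poly1.
Qed.

Lemma lpolyV_rev p : lpolyV p * lq ^+ size p = lpoly (\sum_(i < size p) p`_i *: 'X^(size p - i)).
Proof.
rewrite rmorph_sum /lpolyV horner_poly /=.
have -> : (\sum_(i < size p) (p`_i)%:~R * lqV ^+ i) * lq ^+ size p =
  \sum_(i < size p) (p`_i)%:~R * lq ^+ (size p - i).
  rewrite mulr_suml; apply: eq_bigr => i _; rewrite -mulrA; congr (_ * _).
  have -> : lq ^+ size p = lq ^+ i * lq ^+ (size p - i).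
    by rewrite -exprD subnKC// ltnW.
  by rewrite mulrA -exprMn lqVK expr1n mul1r.
apply: eq_bigr => i _; rewrite -mul_polyC rmorphM rmorphXn /= -/lq; congr (_ * _).
by rewrite -[p`_i in RHS]intz !rmorph_int.
Qed.

(** The bar involution turns positive powers of q into negative ones, so it cannot fix a
    nonzero polynomial without constant term. *)
Lemma lbar_fixed_lqZq a : lqZq a -> lbar a = a -> a = 0.
Proof.
move=> [p _ <-]; rewrite -[lq * _]rmorphM lbar_lpoly; set r := 'X * p => e.
have := congr1 (fun x => x * lq ^+ size r) e; rewrite lpolyV_rev /lq -rmorphXn -rmorphM.
move=> /lpoly_inj e'; have: (size (r * 'X^(size r))%R <= (size r).+1)%N.
  rewrite -e'; apply: (leq_trans (size_sum _ _ _)); apply/bigmax_leqP => i _.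
  by apply: (leq_trans (size_scale_leq _ _)); rewrite size_polyXn ltnS leq_subr.
have [->|r0] := eqVneq r 0; first by rewrite rmorph0.
rewrite size_mulXn// -addn1 [(_ + 1)%N]addnC leq_add2r => /size1_polyC rE.
by rewrite rE /r coefXM /= rmorph0.
Qed.

Lemma lpolyC (k : int) : lpoly k%:P = k%:~R.
Proof. by rewrite -[k in LHS]intz !rmorph_int. Qed.

Lemma lbarz (n : int) : lbar n%:~R = n%:~R.
Proof. exact: rmorph_int. Qed.

End Laurent.

Local Open Scope classical_set_scope.

Lemma fsum_ind (V : nmodType) (I : choiceType) (A : set I) (F : I -> V) (K : V -> Prop) :
  K 0%R -> (forall x y, K x -> K y -> K (x + y)%R) -> (forall i, A i -> K (F i)) ->
  K (\sum_(i \in A) F i)%R.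
Proof.
move=> K0 KD KF; case: finite_supportP => [_|Y YA _ _]; first by rewrite big_nil.
by rewrite big_seq; apply: big_ind => // i /YA; exact: KF.
Qed.

(** * Spans and coordinates over Laurent polynomials *)

Section Scale.
Variables (W : groupType) (S : set W) (M : lmodType (hecke S)).
Local Open Scope classical_set_scope.
Local Open Scope ring_scope.
Local Notation "a *' m" := (@ascale W S _ a m) (at level 40, left associativity).
Implicit Types (a b : laurent) (m n : M).

Lemma ascaleDl a b m : (a + b) *' m = a *' m + b *' m.
Proof. by rewrite /ascale scalerDl scalerDl. Qed.
Lemma ascaleDr a m n : a *' (m + n) = a *' m + a *' n.
Proof. by rewrite /ascale scalerDr. Qed.
Lemma ascaleNr a m : a *' (- m) = - (a *' m).
Proof. by rewrite /ascale scalerN. Qed.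
Lemma ascaleNl a m : (- a) *' m = - (a *' m).
Proof. by rewrite /ascale !scaleNr. Qed.
Lemma ascaleBl a b m : (a - b) *' m = a *' m - b *' m.
Proof. by rewrite ascaleDl ascaleNl. Qed.
Lemma ascaleBr a m n : a *' (m - n) = a *' m - a *' n.
Proof. by rewrite ascaleDr ascaleNr. Qed.
Lemma ascaleA a b m : a *' (b *' m) = (a * b) *' m.
Proof. by rewrite /ascale scalerA -scalerAl mul1r scalerA. Qed.
Lemma ascale1 m : 1 *' m = m.
Proof. by rewrite /ascale !scale1r. Qed.
Lemma ascale0 m : 0 *' m = 0.
Proof. by rewrite /ascale !scale0r. Qed.
Lemma ascaler0 a : a *' (0 : M) = 0.
Proof. by rewrite /ascale scaler0. Qed.
Lemma ascale_mulrz (k : int) m : k%:~R *' m = m *~ k.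
Proof. by rewrite /ascale -hscalE rmorph_int scaler_int. Qed.
Lemma scale_ascale h a m : h *: (a *' m) = a *' (h *: m).
Proof. by rewrite /ascale !scalerA -scalerAl mul1r -scalerAr mulr1. Qed.
Lemma ascale_sum a (I : Type) (r : seq I) (P : pred I) (F : I -> M) :
  a *' (\sum_(i <- r | P i) F i) = \sum_(i <- r | P i) a *' F i.
Proof. by rewrite /ascale scaler_sumr. Qed.

Section Span.
Variables (U : Type).

(** The combinations of the b_u, u in X, with coefficients in P. The set P is only
    a condition on the coefficients, not a ring acting on the module, which allows
    congruences modulo q to be stated as membership in a span over q Z[q]. *)
Inductive lspan (P : set laurent) (X : set U) (b : U -> M) : M -> Prop :=
| lspan0 : lspan P X b 0
| lspan_cons a u m : P a -> X u -> lspan P X b m -> lspan P X b (a *' b u + m).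

Variables (P : set laurent) (X : set U) (b : U -> M).

Lemma lspan1 a u : P a -> X u -> lspan P X b (a *' b u).
Proof. by move=> Pa Xu; rewrite -[_ *' _]addr0; apply: lspan_cons => //; exact: lspan0. Qed.

Lemma lspanD m n : lspan P X b m -> lspan P X b n -> lspan P X b (m + n).
Proof.
elim=> [|a u {}m Pa Xu _ IH] hn; first by rewrite add0r.
by rewrite -addrA; apply: lspan_cons => //; exact: IH.
Qed.

Lemma lspan_scale (P' : set laurent) a m : (forall x, P' x -> P (a * x)) ->
  lspan P' X b m -> lspan P X b (a *' m).
Proof.
move=> Pa; elim=> [|x u {}m Px Xu _ IH]; first by rewrite ascaler0; exact: lspan0.
by rewrite ascaleDr ascaleA; apply: lspan_cons => //; exact: Pa.
Qed.

Lemma lspanS (P' : set laurent) (X' : set U) m :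
  lspan P' X' b m -> P' `<=` P -> X' `<=` X -> lspan P X b m.
Proof.
move=> hm PP XX; elim: hm => [|a u {}m /PP Pa /XX Xu _ IH]; first exact: lspan0.
exact: lspan_cons.
Qed.

Lemma lspan_sum (I : choiceType) (A : set I) (F : I -> M) :
  (forall i, A i -> lspan P X b (F i)) -> lspan P X b (\sum_(i \in A) F i).
Proof.
by move=> h; apply: fsum_ind => //; [exact: lspan0|exact: lspanD].
Qed.

Hypothesis Pring : nu_subring P.

Lemma nu_subringN a : P a -> P (- a).
Proof. by case: Pring => P0 PB _ Pa; rewrite -sub0r; exact: PB. Qed.

Lemma nu_subringD a a' : P a -> P a' -> P (a + a').
Proof. by case: Pring => _ PB _ Pa /nu_subringN Pa'; rewrite -[a']opprK; exact: PB. Qed.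

Lemma lspanN m : lspan P X b m -> lspan P X b (- m).
Proof.
elim=> [|a u {}m Pa Xu _ IH]; first by rewrite oppr0; exact: lspan0.
by rewrite opprD -ascaleNl; apply: lspan_cons => //; exact: nu_subringN.
Qed.

Lemma lspanB m n : lspan P X b m -> lspan P X b n -> lspan P X b (m - n).
Proof. by move=> hm hn; apply: lspanD => //; exact: lspanN. Qed.

End Span.

Section Coordinates.
Variables (U : choiceType) (V : set U) (b : U -> M).

Lemma fsum_supp (a : U -> laurent) (F : set U) :
  F `<=` V -> (forall u, V u -> a u <> 0 -> F u) ->
  \sum_(u \in V) (a u *' b u) = \sum_(u \in F) (a u *' b u).
Proof.
move=> FV aF; apply/esym/fsbig_widen => // u [Vu Fu] /=.
have [->|/eqP au] := eqVneq (a u) 0; first by rewrite ascale0.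
by case: Fu; exact: aF.
Qed.

Hypothesis hb : is_basis V b.

Definition coord (m : M) : U -> laurent := projT1 (cid (hb m)).

Lemma coordP m : [/\ finite_set [set u | coord m u <> 0],
  [set u | coord m u <> 0] `<=` V & m = \sum_(u \in V) (coord m u *' b u)].
Proof. by rewrite /coord; case: cid => a []. Qed.

Lemma coord_uniq m (a : U -> laurent) : finite_set [set u | a u <> 0] ->
  [set u | a u <> 0] `<=` V -> m = \sum_(u \in V) (a u *' b u) -> coord m = a.
Proof. by move=> *; rewrite /coord; case: cid => c [_ /= cu]; exact: cu. Qed.

Lemma coord_fsum (F : set U) (a : U -> laurent) u : finite_set F -> F `<=` V ->
  coord (\sum_(u \in F) (a u *' b u)) u = if u \in F then a u else 0.
Proof.
move=> Ffin FV; pose a' u := if u \in F then a u else 0.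
have a'F v : a' v <> 0 -> F v by rewrite /a'; case: ifP => //; rewrite inE.
rewrite (@coord_uniq _ a')//; first exact: sub_finite_set a'F Ffin.
  by move=> v /a'F/FV.
rewrite (@fsum_supp a' F)//; last by move=> v _; exact: a'F.
by apply: eq_fsbigr => v vF; rewrite /a' vF.
Qed.

Lemma coord_inj m n : (forall u, V u -> coord m u = coord n u) -> m = n.
Proof.
move=> e; have [_ _ ->] := coordP m; have [_ _ ->] := coordP n.
by apply: eq_fsbigr => u /[!inE] Vu; rewrite e.
Qed.

Lemma coordD m n u : coord (m + n) u = coord m u + coord n u.
Proof.
have [mf mV mE] := coordP m; have [nf nV nE] := coordP n.
set F := [set u | coord m u <> 0] `|` [set u | coord n u <> 0].
have Ff : finite_set F by rewrite finite_setU.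
have FV : F `<=` V by move=> v [/mV|/nV].
rewrite {1}mE {1}nE (@fsum_supp _ F)//; last by move=> v _; left.
rewrite (@fsum_supp _ F FV); last by move=> v _; right.
rewrite -fsbig_split//=.
under eq_fsbigr do rewrite -ascaleDl.
rewrite coord_fsum//; case: ifPn => // /negP uF.
have [mu nu] : coord m u = 0 /\ coord n u = 0.
  by split; apply: contra_notP uF => h; rewrite inE; [left|right].
by rewrite mu nu addr0.
Qed.

Lemma coordZ a m u : coord (a *' m) u = a * coord m u.
Proof.
have [mf mV mE] := coordP m; rewrite {1}mE (@fsum_supp _ [set u | coord m u <> 0])//.
rewrite fsbig_finite// ascale_sum -fsbig_finite//.
under eq_fsbigr do rewrite ascaleA.
rewrite coord_fsum//; case: ifPn => // /negP uF.
suff -> : coord m u = 0 by rewrite mulr0.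
by apply: contra_notP uF; rewrite inE.
Qed.

Lemma coordN m u : coord (- m) u = - coord m u.
Proof. by rewrite -[in LHS](ascale1 m) -ascaleNl coordZ mulN1r. Qed.

Lemma coordB m n u : coord (m - n) u = coord m u - coord n u.
Proof. by rewrite coordD coordN. Qed.

Lemma coord0 u : coord 0 u = 0.
Proof. by rewrite -(ascale0 0) coordZ mul0r. Qed.

Lemma coord_bigsum (K : choiceType) (A : set K) (F : K -> M) u : finite_set A ->
  coord (\sum_(i \in A) F i) u = \sum_(i \in A) coord (F i) u.
Proof.
move=> Af; rewrite !fsbig_finite//.
by apply: (big_morph (coord^~ u)) => [m n|]; rewrite ?coordD ?coord0.
Qed.

Lemma coord_basis v u : V v -> coord (b v) u = (u == v)%:R.
Proof.
move=> Vv; have -> : b v = \sum_(u \in [set v]) (1 *' b u) by rewrite fsbig_set1 ascale1.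
rewrite coord_fsum//; last by move=> _ ->.
by have [->|uv] := eqVneq u v; [rewrite mem_set|rewrite memNset//; exact/eqP].
Qed.

Lemma lspan_coord (P : set laurent) (X : set U) m u : nu_subring P -> X `<=` V ->
  lspan P X b m -> P (coord m u) /\ (coord m u <> 0 -> X u).
Proof.
move=> Pr XV; elim=> [|a v n Pa Xv _ [IH1 IH2]].
  by rewrite coord0; split=> //; case: Pr.
rewrite coordD coordZ coord_basis; last exact: XV.
have [uv|uv] := eqVneq u v; last by rewrite mulr0 add0r.
by subst v; rewrite mulr1; split=> //; exact: nu_subringD.
Qed.

Lemma coord_lspan (P : set laurent) (X : set U) m :
  (forall u, V u -> coord m u <> 0 -> P (coord m u) /\ X u) -> lspan P X b m.
Proof.
move=> h; have [mf mV ->] := coordP m.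
rewrite (@fsum_supp _ [set u | coord m u <> 0])//.
by apply: lspan_sum => u /= cu; have [Pa Xu] := h u (mV _ cu) cu; exact: lspan1.
Qed.

Lemma lspan_setT m : lspan setT V b m.
Proof. exact: coord_lspan. Qed.

Lemma coord_sum (X : set U) (P : set laurent) m : nu_subring P -> X `<=` V -> finite_set X ->
  lspan P X b m -> m = \sum_(u \in X) (coord m u *' b u).
Proof.
move=> Pr XV Xf hm; have [_ _ {1}->] := coordP m; apply: fsum_supp => // u _.
by have [_] := lspan_coord u Pr XV hm.
Qed.

End Coordinates.
End Scale.

Local Open Scope ring_scope.

Lemma fsum_only (V : zmodType) (U : choiceType) (A : set U) (u : U) (F : U -> V) :
  A u -> (forall v, A v -> v <> u -> F v = 0) -> \sum_(v \in A) F v = F u.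
Proof.
move=> Au h; have <- : \sum_(v \in [set u]) F v = F u by rewrite fsbig_set1.
apply/esym/fsbig_widen => [_ -> //|v [Av vu]].
exact: h.
Qed.

(** * Unitriangular changes of basis *)

Section Triangular.
Variables (W : groupType) (S : set W) (hWS : coxeter_system S).
Variables (I : set W) (M : lmodType (hecke S)).
Local Notation len := (len S).
Local Notation blt := (bruhat_lt S).
Local Notation "a *' m" := (@ascale W S _ a m) (at level 40, left associativity).
Implicit Types (b c : W -> M).

Definition below (w : W) : set W := [set y | I y /\ blt y w].

Lemma finite_below w : finite_set (below w).
Proof. by apply: sub_finite_set (finite_blt hWS w) => x []. Qed.

Lemma below_trans y w : blt y w -> below y `<=` below w.
Proof. by move=> yw x [Ix xy]; split=> //; exact: blt_trans yw. Qed.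

Lemma below_sub w : below w `<=` I. Proof. by move=> x []. Qed.

Lemma lspan_change (P P' : set laurent) (X : set W) b c m :
  (forall u, X u -> lspan P X c (b u - c u)) ->
  (forall a p, P' a -> P p -> P' (a * p)) -> lspan P' X b m -> lspan P' X c m.
Proof.
move=> bc PP; elim=> [|a u n Pa Xu _ IH]; first exact: lspan0.
apply: lspanD => //; rewrite -[b u](subrK (c u)) ascaleDr; apply: lspanD; last exact: lspan1.
by apply: lspan_scale (bc u Xu) => x; exact: PP.
Qed.

(** The inverse of a unitriangular matrix with entries in a possibly nonunital ring P has its
    entries in P as well: by induction on the length, the b_u with u < w may be replaced by
    the c_u in the expansion of c_w - b_w. *)
Lemma unitri_inv (P : set laurent) b c : nu_subring P ->
  (forall w, I w -> lspan P (below w) b (c w - b w)) ->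
  forall w, I w -> lspan P (below w) c (b w - c w).
Proof.
move=> Pr bc w; elim/(@len_ind W S): w => w IH Iw.
rewrite -opprB; apply: lspanN => //.
apply: (@lspan_change P P _ b) (bc w Iw); last by case: Pr.
move=> u [Iu uw]; apply: (lspanS (IH u (blt_len uw) Iu)) => //; exact: below_trans.
Qed.

Lemma lspan_fsum (X : set W) c m : lspan setT X c m ->
  exists a : W -> laurent, [/\ finite_set [set u | a u <> 0],
    [set u | a u <> 0] `<=` X & m = \sum_(u \in X) (a u *' c u)].
Proof.
elim=> [|a0 u n _ Xu _ [a [af aX nE]]].
  exists (fun=> 0); split=> //; first by apply: (@sub_finite_set _ _ set0) => // u /=.
  by rewrite fsbig1// => u _; rewrite ascale0.
pose a' v := (if v == u then a0 else 0) + a v.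
set F := [set u] `|` [set v | a v <> 0].
have Ff : finite_set F by rewrite finite_setU.
have FX : F `<=` X by move=> v [->|/aX].
have a'F v : a' v <> 0 -> F v.
  move=> h; have [->|vu] := eqVneq v u; first by left.
  by right; move: h; rewrite /a' (negbTE vu) add0r.
exists a'; split; [exact: sub_finite_set Ff|by move=> v /a'F/FX|].
rewrite (@fsum_supp _ _ _ _ X c a' F FX); last by move=> v _; exact: a'F.
rewrite nE (@fsum_supp _ _ _ _ X c a F FX); last by move=> v _; right.
under [RHS]eq_fsbigr do rewrite ascaleDl.
rewrite fsbig_split//=; congr (_ + _).
rewrite (@fsum_only _ _ F u) ?eqxx//; first by left.
by move=> v _ /eqP/negbTE->; rewrite ascale0.
Qed.

(** The c_w generate by [unitri_inv]. They are independent because in a linear relation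
    among them an element of maximal length occurs in the b-expansion of its own c only,
    so that its coefficient is zero. *)
Lemma unitri_basis b c : is_basis I b ->
  (forall w, I w -> lspan setT (below w) b (c w - b w)) -> is_basis I c.
Proof.
move=> hb bc m.
have cb := unitri_inv nu_subringT bc.
have [|a [af aI mE]] := @lspan_fsum I c m.
  apply: (@lspan_change setT setT I b) (lspan_setT hb m) => // u Iu.
  by apply: (lspanS (cb u Iu)) => //; exact: below_sub.
exists a; split=> // a' [a'f a'I mE'].
set F := [set u | a u <> 0] `|` [set u | a' u <> 0].
have Ff : finite_set F by rewrite finite_setU.
have FI : F `<=` I by move=> v [/aI|/a'I].
pose d u := a u - a' u.
have dsum : \sum_(u \in F) (d u *' c u) = 0.
  rewrite /d; under eq_fsbigr do rewrite ascaleDl.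
  rewrite fsbig_split//= -(@fsum_supp _ _ _ _ I c a F)//; last by move=> v _; left.
  under [X in _ + X]eq_fsbigr do rewrite ascaleNl.
  rewrite fsbig_finite//= sumrN -fsbig_finite//.
  rewrite -(@fsum_supp _ _ _ _ I c a' F)//; last by move=> v _; right.
  by rewrite -mE -mE' subrr.
have [N FN] : exists N, forall u, F u -> (len u < N)%N.
  exists (\max_(u <- fset_set F) len u).+1 => u Fu; rewrite ltnS.
  by apply: leq_bigmax_seq => //; rewrite in_fset_set//; exact: mem_set.
have dF u : ~ F u -> d u = 0.
  move=> Fu; rewrite /d; have [-> ->] : a u = 0 /\ a' u = 0.
    by split; apply: contra_notP Fu => ?; [left|right].
  by rewrite subrr.
(* Descending induction on the length, starting above the support of [d]. *)
have d0 k : forall u, (N <= len u + k)%N -> d u = 0.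
  elim: k => [|k IH] u Nu.
    by apply: dF => /FN; rewrite ltnNge -(addn0 (len u)) Nu.
  have [Fu|/dF//] := pselect (F u).
  have := congr1 (fun x => coord hb x u) dsum.
  rewrite coord_bigsum// (@fsum_only _ _ F u) ?coord0//; last first.
    move=> v Fv vu; rewrite coordZ.
    have Iv := FI _ Fv.
    have e : coord hb (c v) u = coord hb (c v - b v) u.
      rewrite coordB [X in _ - X]coord_basis//.
      by have [uv|] := eqVneq u v; [case: vu|rewrite subr0].
    have [_ cu] := lspan_coord hb u nu_subringT (@below_sub v) (bc v Iv).
    have [h|/eqP h] := eqVneq (coord hb (c v) u) 0; first by rewrite h mulr0.
    have [_ /blt_len uv] : below v u by apply: cu; rewrite -e.
    by rewrite IH ?mul0r//; lia.
  rewrite coordZ -[c u](subrK (b u)) coordD coord_basis; last exact: FI.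
  rewrite eqxx; have [_ cu] := lspan_coord hb u nu_subringT (@below_sub u) (bc u (FI _ Fu)).
  have -> : coord hb (c u - b u) u = 0.
    by apply: contrapT => /cu[_ /(blt_irr)].
  by rewrite add0r mulr1.
apply/funext => u; apply/eqP; rewrite -subr_eq0; apply/eqP.
by apply: (d0 N); rewrite leq_addl.
Qed.

End Triangular.

(** * Ascents and descents in an ideal *)

Section IdealCombinatorics.
Variables (W : groupType) (S : set W) (hWS : coxeter_system S).
Variables (I J : set W) (hI : left_ideal S I) (hJ : J `<=` Pos S I).
Local Notation len := (len S).
Local Notation blt := (bruhat_lt S).
Local Notation SD := (SD S).
Local Notation SA := (SA S I).
Local Notation WD := (WD S J).
Local Notation WA := (WA S I J).
Local Notation Desc := (Desc S J).
Local Notation Asc := (Asc S I J).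
Local Notation below := (below S I).
Implicit Types (s y w z : W).

Lemma ideal1 : I 1%g.
Proof.
have [[w Iw] down] := hI; apply: down Iw.
by rewrite /left_weak invg1 mulg1 (len1 hWS) addn0.
Qed.

Lemma ideal_desc s w : S s -> I w -> blt (s * w)%g w -> I (s * w)%g.
Proof.
move=> Ss Iw /blt_len l; have [_ down] := hI; apply: down Iw.
rewrite /left_weak invgM mulgA mulgV mul1g (lenV hWS).
have := len_genl hWS w Ss; rewrite l => ->.
rewrite -add1n; congr (_ + _)%N; apply/eqP; rewrite eqn_leq (len_gen_le hWS)// andbT lt0n.
by apply/eqP => /(len_eq0 hWS); exact: (gen_neq1 hWS Ss).
Qed.

Lemma ideal_coset w : I w -> coset_reps S J w.
Proof. by move=> Iw t /hJ[_]; exact. Qed.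

Lemma SA_SD s w : SA w s -> SD (s * w)%g s.
Proof. by move=> [Ss l _]; split; rewrite // (genK hWS). Qed.

Lemma SD_SA s w : I w -> SD w s -> SA (s * w)%g s.
Proof. by move=> Iw [Ss l]; split; rewrite // (genK hWS). Qed.

Lemma SD_ideal s w : I w -> SD w s -> I (s * w)%g.
Proof. by move=> Iw [Ss l]; exact: ideal_desc. Qed.

Lemma AscP s w : Asc w s -> S s /\ blt w (s * w)%g.
Proof. by move=> [[]|[]]. Qed.

Lemma Desc_gen s w : Desc w s -> S s.
Proof. by move=> [[]|[]]. Qed.

Lemma SA_not_Desc s w : SA w s -> ~ Desc w s.
Proof.
move=> [Ss l Isw] [[_ l']|[_ _]]; last by apply; exact: ideal_coset.
exact: blt_irr (blt_trans l l').
Qed.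

Lemma Asc_not_Desc s w : Asc w s -> ~ Desc w s.
Proof.
move=> [/SA_not_Desc//|[Ss l [Dsw _]]] [[_ l']|[_ _ //]].
exact: blt_irr (blt_trans l l').
Qed.

Lemma not_Desc_Asc s w : S s -> ~ Desc w s -> Asc w s.
Proof.
move=> Ss nD; have l : blt w (s * w)%g.
  by apply: (blt_gen_asc hWS) => // h; apply: nD; left.
have Dsw : coset_reps S J (s * w)%g by apply: contrapT => h; apply: nD; right.
by have [Isw|nI] := pselect (I (s * w)%g); [left|right].
Qed.

Lemma WA_not_SA s w : WA w s -> ~ SA w s.
Proof. by move=> [_ _ [_ nI]] [_ _]. Qed.

Lemma SA_neq s x y : SA x s -> Asc y s -> y <> (s * x)%g.
Proof. by move=> /SA_SD sx ya e; rewrite e in ya; apply: Asc_not_Desc ya _; left. Qed.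

(** * The action of the generators in coordinates *)

Section Action.
Variables (M : lmodType (hecke S)) (Q : W -> W -> {poly int}) (c : W -> M).
Local Notation "a *' m" := (@ascale W S _ a m) (at level 40, left associativity).
Local Notation T := (hT S).
Local Notation mu := (muQ Q).

Definition lower_desc s w : set W := [set y | [/\ I y, blt y w & Desc y s]].

Lemma lower_desc_below s w : lower_desc s w `<=` below w.
Proof. by move=> y []. Qed.

Lemma finite_lower_desc s w : finite_set (lower_desc s w).
Proof. exact: sub_finite_set (@lower_desc_below s w) (finite_below hWS I w). Qed.

(** What T_s adds to [q c_w] at an ascent: the edges of the graph that lead from w into
    vertices with s in their label. *)
Definition mu_part s w : M :=
  (if `[< SA w s >] then c (s * w)%g else 0) + \sum_(y \in lower_desc s w) (c y *~ mu y w).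

Definition act_formula s w : Prop :=
  T s *: c w = if `[< Desc w s >] then - (lqV *' c w) else lq *' c w + mu_part s w.

Lemma graph_formulasP :
  graph_formulas I J Q c <-> forall s w, S s -> I w -> act_formula s w.
Proof.
split=> h s w Ss Iw.
  have [hD hWA hSA] := h s w Ss Iw; rewrite /act_formula /mu_part.
  case: asboolP => [/hD//|/(not_Desc_Asc Ss)[a|a]]; first by rewrite asboolT// hSA// addrA.
  by rewrite asboolF ?add0r ?hWA//; exact: WA_not_SA.
have := h s w Ss Iw; rewrite /act_formula /mu_part => {}h; split.
- by move=> d; rewrite h asboolT.
- move=> a; rewrite h asboolF; last by apply: Asc_not_Desc; right.
  by rewrite asboolF ?add0r//; exact: WA_not_SA.
- move=> a; rewrite h asboolF; last by apply: Asc_not_Desc; left.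
  by rewrite asboolT// addrA.
Qed.

Hypothesis hc : is_basis I c.
Local Notation coord := (coord hc).

Lemma coord_mu_part s x y : I x -> I y -> coord (mu_part s x) y =
  (`[< SA x s >] && (y == s * x)%g)%:R + (if `[< blt y x /\ Desc y s >] then (mu y x)%:~R else 0).
Proof.
move=> Ix Iy; rewrite coordD; congr (_ + _).
  by case: asboolP => [[_ _ Isx]|_]; rewrite ?coord_basis// coord0.
under eq_fsbigr do rewrite -ascale_mulrz.
rewrite coord_fsum; [|exact: finite_lower_desc|by move=> ? []].
case: asboolP => [[yx Dy]|n]; first by rewrite mem_set.
by rewrite memNset// => -[_ yx Dy]; apply: n.
Qed.

Lemma coord_act_desc s x y : I x -> act_formula s x -> Desc x s ->
  coord (T s *: c x) y = - lqV * (y == x)%:R.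
Proof. by move=> Ix -> Dx; rewrite asboolT// -ascaleNl coordZ coord_basis. Qed.

Lemma coord_act_asc s x y : I x -> I y -> act_formula s x -> Asc x s ->
  coord (T s *: c x) y = lq * (y == x)%:R + coord (mu_part s x) y.
Proof.
move=> Ix Iy -> Ax; rewrite asboolF; last exact: Asc_not_Desc.
by rewrite coordD coordZ coord_basis.
Qed.

(** T_s sends each c_x into a multiple of c_x plus terms with s in their label, so the
    coordinate at a vertex v without s in its label is only multiplied by q. The formulas
    are assumed on X only, to allow use in an induction that proves them. *)
Lemma coord_act_at_asc (X : set W) s m v : (forall x, X x -> I x /\ act_formula s x) ->
  lspan setT X c m -> I v -> Asc v s -> coord (T s *: m) v = lq * coord m v.
Proof.
move=> hX hm Iv Av; have [Ss _] := AscP Av.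
elim: hm => [|a x n _ /hX[Ix fx] _ IH]; first by rewrite scaler0 coord0 mulr0.
rewrite scalerDr scale_ascale !coordD !coordZ IH mulrDr; congr (_ + _).
rewrite mulrCA coord_basis//; congr (_ * _).
have [Dx|/(not_Desc_Asc Ss) Ax] := pselect (Desc x s).
  rewrite coord_act_desc//; have [vx|_] := eqVneq v x; last by rewrite !mulr0.
  by subst v; case: (Asc_not_Desc Av).
rewrite coord_act_asc// coord_mu_part//.
rewrite [in X in _ + (_ + X)]asboolF; last by case=> _; exact: Asc_not_Desc.
case: asboolP => [SAx|_]; last by rewrite !addr0.
by have [/(@SA_neq _ _ _ SAx Av)|_] := eqVneq v (s * x)%g; rewrite ?addr0.
Qed.

(** The terms that reach a vertex v with s in its label: c_v itself, c_sv through the edge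
    from sv up to v, and the higher vertices x without s in their label through the edges
    of weight mu_(v,x). *)
Lemma coord_act_at_desc (X : set W) s m v : finite_set X ->
  (forall x, X x -> I x /\ act_formula s x) -> lspan setT X c m -> I v -> Desc v s ->
  coord (T s *: m) v = - lqV * coord m v + (if `[< SD v s >] then coord m (s * v)%g else 0) +
    \sum_(x \in [set x | [/\ X x, blt v x & ~ Desc x s]]) ((mu v x)%:~R * coord m x).
Proof.
move=> Xf hX hm Iv Dv; have Ss := Desc_gen Dv.
set G := [set x | _]; have Gf : finite_set G by apply: sub_finite_set Xf => x [].
elim: hm => [|a x n _ Xx _ IH].
  rewrite scaler0 !coord0 mulr0 add0r if_same add0r fsbig1// => x _.
  by rewrite coord0 mulr0.
have [Ix fx] := hX x Xx.
rewrite scalerDr scale_ascale !coordD !coordZ IH.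
under [X in _ = _ + X]eq_fsbigr do rewrite coordD coordZ coord_basis// mulrDr.
rewrite fsbig_split//= coord_basis//.
have -> : (if `[< SD v s >] then a * coord (c x) (s * v)%g + coord n (s * v)%g else 0) =
  (if `[< SD v s >] then a * (s * v == x)%g%:R else 0) +
  (if `[< SD v s >] then coord n (s * v)%g else 0).
  by case: asboolP; rewrite ?addr0// coord_basis.
have -> : \sum_(i \in G) (mu v i)%:~R * (a * (i == x)%:R) =
  a * if `[< G x >] then (mu v x)%:~R else 0.
  case: asboolP => Gx; last first.
    rewrite fsbig1 ?mulr0// => i Gi; have [ix|_] := eqVneq i x; last by rewrite !mulr0.
    by rewrite ix in Gi.
  rewrite (@fsum_only _ _ G x)//; first by rewrite eqxx mulr1 mulrC.
  by move=> i _ /eqP/negbTE->; rewrite !mulr0.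
suff -> : coord (T s *: c x) v = - lqV * (v == x)%:R +
  (if `[< SD v s >] then (s * v == x)%g%:R else 0) +
  (if `[< G x >] then (mu v x)%:~R else 0).
  by case: asboolP => _; case: asboolP => _; ring.
have [Dx|nDx] := pselect (Desc x s).
  rewrite coord_act_desc// [in X in _ = _ + X]asboolF ?addr0; last by case.
  case: asboolP => SDv; rewrite ?addr0//.
  have [svx|_] := eqVneq (s * v)%g x; rewrite ?addr0//.
  by subst x; case: (SA_not_Desc (SD_SA Iv SDv)).
have Ax := not_Desc_Asc Ss nDx.
rewrite coord_act_asc// coord_mu_part//.
have [vx|_] := eqVneq v x; first by subst v.
rewrite !mulr0 !add0r; congr (_ + _).
  have [vsx|vsx] := eqVneq v (s * x)%g; last first.
    rewrite andbF; have [svx|_] := eqVneq (s * v)%g x; last by rewrite if_same.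
    by rewrite -svx (genK hWS)// eqxx in vsx.
  subst v; rewrite (genK hWS)// eqxx andbT.
  case: asboolP => [/SA_SD h|h]; first by rewrite asboolT.
  rewrite asboolF// => h'; apply: h; move: (SD_SA Iv h'); rewrite (genK hWS)//.
by congr (if _ then _ else _); apply: asbool_equiv_eq; split=> [[]//|[]].
Qed.

(** * The recursion as an equation in the module *)

Section Change.
Hypothesis hQ0 : forall y w, I y -> I w -> ~ blt y w -> Q y w = 0.

(** The basis of the ideal module, expressed in the basis of the vertices:
    [b_w = c_w + q sum_(y < w) q_(y,w) c_y]. *)
Definition std_elt w : M := c w + \sum_(y \in below w) ((lq * lpoly (Q y w)) *' c y).

Lemma std_eltE w : std_elt w - c w = \sum_(y \in below w) ((lq * lpoly (Q y w)) *' c y).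
Proof. by rewrite /std_elt addrAC subrr add0r. Qed.

Lemma std_elt_lspan w : lspan lqZq (below w) c (std_elt w - c w).
Proof.
rewrite std_eltE; apply: lspan_sum => y yw; apply: lspan1 => //.
exact: lqZq_lpoly.
Qed.

Lemma std_elt1 : std_elt 1%g = c 1%g.
Proof.
rewrite /std_elt (_ : below 1%g = set0) ?fsbig_set0 ?addr0//.
by apply/seteqP; split=> // y [_ /blt_len]; rewrite (len1 hWS).
Qed.

Lemma coord_std_elt w y : I w -> I y -> coord (std_elt w) y = (y == w)%:R + lq * lpoly (Q y w).
Proof.
move=> Iw Iy; rewrite coordD coord_basis// coord_fsum; last exact: below_sub.
  congr (_ + _); case: ifPn => // /negP yw; rewrite hQ0 ?rmorph0 ?mulr0// => h.
  by apply: yw; rewrite mem_set.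
exact: finite_below.
Qed.

(** The defining expression for q_(y,sw) at a vertex y with s in D(y), strong and weak
    descents taken together. *)
Definition rec_rhs s y w : laurent :=
  - lqV * lpoly (Q y w - (mu y w)%:P) +
  (if `[< SD y s >] then lpoly (Q (s * y)%g w) else 0) +
  \sum_(x \in sum_range S I J s y w) ((mu y x)%:~R * lpoly (Q x w)).

Hypothesis hF : forall s w, S s -> I w -> act_formula s w.

Lemma coord_act_std_elt_asc s w y : I y -> Asc y s ->
  coord (T s *: std_elt w) y = lq * coord (std_elt w) y.
Proof.
move=> Iy Ay; have [Ss _] := AscP Ay.
by apply: (@coord_act_at_asc I) => // [x Ix|]; [split=> //; exact: hF|exact: lspan_setT].
Qed.

(** In [coord_act_at_desc] the coordinates of b_w are q q_(x,w) at x < w, and 1 at x = w. The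
    latter contributes mu_(y,w), which cancels the constant term of q_(y,w), so that for y
    other than sw everything is divisible by q. *)
Lemma coord_act_std_elt_desc s w y : I w -> SA w s -> I y -> Desc y s ->
  coord (T s *: std_elt w) y = if y == (s * w)%g then 1 else lq * rec_rhs s y w.
Proof.
move=> Iw SAw Iy Dy; have Ss := Desc_gen Dy.
pose X := [set x | I x /\ bruhat_le S x w].
have Xf : finite_set X by apply: sub_finite_set (finite_ble hWS w) => x [].
have std_eltX : lspan setT X c (std_elt w).
  rewrite -[std_elt w](subrK (c w)); apply: lspanD; last first.
    by rewrite -[c w]ascale1; apply: lspan1 => //; split=> //; exact: ble_refl.
  by apply: (lspanS (std_elt_lspan w)) => // x [Ix []].
rewrite (coord_act_at_desc Xf _ std_eltX)//; last first.
  by move=> x [Ix _]; split=> //; exact: hF.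
have yw : (y == w) = false.
  by apply/eqP => e; rewrite e in Dy; exact: SA_not_Desc SAw Dy.
rewrite coord_std_elt// yw add0r.
set G := [set x | _]; have Gf : finite_set G by apply: sub_finite_set Xf => x [].
have -> : \sum_(x \in G) ((mu y x)%:~R * coord (std_elt w) x) = (mu y w)%:~R +
    lq * \sum_(x \in sum_range S I J s y w) ((mu y x)%:~R * lpoly (Q x w)).
  have -> : \sum_(x \in G) ((mu y x)%:~R * coord (std_elt w) x) =
      \sum_(x \in G) ((mu y x)%:~R * (x == w)%:R + lq * ((mu y x)%:~R * lpoly (Q x w))).
    by apply: eq_fsbigr => x /set_mem[[Ix _] _ _]; rewrite coord_std_elt//; ring.
  rewrite fsbig_split//=; congr (_ + _).
    have [yltw|nyw] := pselect (blt y w).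
      rewrite (@fsum_only _ _ G w)//; first by rewrite eqxx mulr1.
        by split=> //; [split=> //; exact: ble_refl|exact: SA_not_Desc].
      by move=> x _ /eqP/negbTE->; rewrite mulr0.
    rewrite fsbig1; first by rewrite /muQ hQ0// coef0.
    move=> x [_ yx _]; have [xw|_] := eqVneq x w; last by rewrite mulr0.
    by rewrite xw in yx.
  have rf : finite_set (sum_range S I J s y w).
    by apply: sub_finite_set Xf => x [Ix _ [xw _] _].
  rewrite [in RHS]fsbig_finite// big_distrr -fsbig_finite//=; apply/esym/fsbig_widen.
    by move=> x [Ix yx xw nD]; split=> //; split=> //; case: xw.
  move=> x [[[Ix xw] yx nD] nr] /=; rewrite hQ0 ?rmorph0 ?mulr0// => xltw.
  by apply: nr.
have [yE|yz] := eqVneq y (s * w)%g.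
  have SDy : SD y s by rewrite yE; exact: SA_SD.
  have nyw : ~ blt y w by rewrite yE => h; case: SAw => _ /(blt_trans h)/blt_irr.
  rewrite asboolT// yE (genK hWS)// -yE coord_std_elt// eqxx.
  rewrite (hQ0 Iy Iw nyw) /muQ (hQ0 Iy Iw nyw) coef0 (hQ0 Iw Iw (@blt_irr _ _ w)).
  rewrite fsbig1; first by rewrite rmorph0 !mulr0 !addr0 add0r.
  by move=> x [_ yx xw _]; case: nyw; exact: blt_trans xw.
have -> : (if `[< SD y s >] then coord (std_elt w) (s * y)%g else 0) =
    lq * (if `[< SD y s >] then lpoly (Q (s * y)%g w) else 0).
  case: asboolP => [SDy|_]; last by rewrite mulr0.
  rewrite coord_std_elt//; last exact: SD_ideal.
  suff -> : (s * y == w)%g = false by rewrite add0r.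
  by apply: contra_neqF yz => /eqP <-; rewrite (genK hWS).
rewrite /rec_rhs rmorphB /= lpolyC !mulrDr !mulrA !mulNr !mulrN lqKV lqVK.
by ring.
Qed.

(** The conditions that the construction imposes at the element sw when it chooses s. *)
Definition recursion s w : Prop :=
  Q w (s * w)%g = 1 /\
  forall y, I y -> blt y (s * w)%g -> y <> w ->
  [/\ Asc y s -> lpoly (Q y (s * w)%g) = lq * lpoly (Q y w),
      SD y s -> lpoly (Q y (s * w)%g) =
        - lqV * lpoly (Q y w - (mu y w)%:P) + lpoly (Q (s * y)%g w) +
        \sum_(x \in sum_range S I J s y w) ((mu y x)%:~R * lpoly (Q x w)) &
      WD y s -> lpoly (Q y (s * w)%g) =
        - lqV * lpoly (Q y w - (mu y w)%:P) +
        \sum_(x \in sum_range S I J s y w) ((mu y x)%:~R * lpoly (Q x w))].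

Lemma SD_not_WD s y : SD y s -> ~ WD y s.
Proof. by move=> [_ l] [_ l' _]; exact: blt_irr (blt_trans l l'). Qed.

Lemma recursion_rhs s w y : recursion s w -> I y -> blt y (s * w)%g -> Desc y s ->
  y <> w -> lpoly (Q y (s * w)%g) = rec_rhs s y w.
Proof.
move=> [_ h] Iy yz Dy yw; have [_ hSD hWD] := h y Iy yz yw; rewrite /rec_rhs.
case: Dy => [SDy|WDy]; first by rewrite asboolT// hSD.
by rewrite asboolF ?addr0 ?hWD// => /SD_not_WD.
Qed.

(** The recursion is the equation T_s b_w = b_sw written in the coordinates of the c_y.
    At an ascent y the left side has q times the coordinate of b_w, at a descent it has q
    times [rec_rhs]. For y not below sw both sides vanish, by the lifting property. *)
Lemma recursionP s w : I w -> SA w s -> T s *: std_elt w = std_elt (s * w)%g <-> recursion s w.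
Proof.
move=> Iw SAw; have [Ss wz Iz] := SAw; have Aw : Asc w s by left.
have wzE : (w == s * w)%g = false by apply/eqP => e; rewrite -e in wz; exact: blt_irr wz.
split=> [h|rec].
  have hc' y : coord (T s *: std_elt w) y = coord (std_elt (s * w)%g) y by rewrite h.
  split.
    apply: lpoly_inj; apply: lqI; have := hc' w; rewrite coord_act_std_elt_asc// !coord_std_elt//.
    rewrite eqxx wzE add0r (hQ0 Iw Iw (@blt_irr _ _ w)) rmorph0 mulr0 addr0 => <-.
    by rewrite (rmorph1 lpoly).
  move=> y Iy yz /eqP/negbTE yw.
  have yzE : (y == s * w)%g = false by apply/eqP => e; rewrite e in yz; exact: blt_irr yz.
  have hD : Desc y s -> lpoly (Q y (s * w)%g) = rec_rhs s y w.
    by move=> Dy; apply: lqI; have := hc' y; rewrite coord_act_std_elt_desc// coord_std_elt// yzE add0r.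
  split=> [Ay|SDy|WDy].
  - apply: lqI; have := hc' y; rewrite coord_act_std_elt_asc// !coord_std_elt// yzE yw !add0r.
    by move<-.
  - by rewrite hD ?/rec_rhs ?asboolT//; left.
  - by rewrite hD ?/rec_rhs ?asboolF ?addr0//; [move/SD_not_WD|right].
apply: (coord_inj (hb := hc)) => y Iy; rewrite [RHS]coord_std_elt//.
have [Dy|/(not_Desc_Asc Ss) Ay] := pselect (Desc y s).
  rewrite coord_act_std_elt_desc//; have [->|yz] := eqVneq y (s * w)%g.
    by rewrite (hQ0 Iz Iz (@blt_irr _ _ _)) rmorph0 mulr0 addr0.
  have yw : y <> w by move=> e; rewrite e in Dy; exact: SA_not_Desc SAw Dy.
  (* For y not below sw the conditions say nothing, but then [rec_rhs] is zero. *)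
  rewrite add0r; congr (_ * _).
  have [ltyz|nyz] := pselect (blt y (s * w)%g); first by rewrite recursion_rhs.
  have nyw : ~ blt y w by move=> h; apply: nyz; exact: blt_trans wz.
  rewrite hQ0// /rec_rhs /muQ hQ0// coef0 subrr rmorph0 mulr0 add0r.
  rewrite fsbig1 ?addr0; last by move=> x [_ yx xw _]; case: nyw; exact: blt_trans xw.
  case: asboolP => // SDy; rewrite hQ0 ?rmorph0//; first exact: SD_ideal.
  move=> h; apply: nyz; rewrite -(genK hWS y Ss).
  exact: blt_mul_asc.
rewrite coord_act_std_elt_asc// coord_std_elt//.
have yzE : (y == s * w)%g = false by apply/eqP; exact: (SA_neq SAw Ay).
have [Qwz h] := rec.
have [->|yw] := eqVneq y w.
  by rewrite Qwz wzE (hQ0 Iw Iw (@blt_irr _ _ w)) rmorph0 (rmorph1 lpoly) mulr0 addr0 add0r /= mulr1n.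
rewrite yzE !add0r; congr (_ * _).
have [ltyz|nyz] := pselect (blt y (s * w)%g).
  by have [hA _ _] := h y Iy ltyz (elimN eqP yw); rewrite hA.
rewrite !hQ0// ?rmorph0 ?mulr0// => yltw; apply: nyz; exact: blt_trans wz.
Qed.

End Change.

Lemma mu_part_lspan s w y : blt w (s * w)%g -> below w y -> S s ->
  lspan polyA (below (s * w)%g) c (mu_part s y).
Proof.
move=> wz [Iy yw] Ss; apply: lspanD.
  case: asboolP => [[_ ysy Isy]|_]; last exact: lspan0.
  rewrite -[c _]ascale1 -[1](rmorph1 lpoly).
  apply: lspan1; first exact: polyA_lpoly.
  by split=> //; exact: blt_mul_asc.
apply: lspan_sum => x [Ix xy _]; rewrite -ascale_mulrz -lpolyC; apply: lspan1.
  exact: polyA_lpoly.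
by split=> //; apply: blt_trans wz; exact: blt_trans yw.
Qed.

(** For a lower vertex y with s in D(y), the coefficient of c_y in [(T_s - q)(b_w - c_w)] gets
    [-(q + q^-1) q q_(y,w)], which is congruent modulo q to [- mu_(y,w)]; the added sum
    compensates that. All other contributions come from ascents y with the factor
    [q q_(y,w)] in front of integers. *)
Lemma act_std_elt_lower s w : S s -> blt w (s * w)%g ->
  (forall y, below w y -> act_formula s y) ->
  lspan lqZq (below (s * w)%g) c
    (T s *: (std_elt w - c w) - lq *' (std_elt w - c w) + \sum_(y \in lower_desc s w) (c y *~ mu y w)).
Proof.
move=> Ss wz hF; rewrite std_eltE.
have bf := finite_below hWS I w.
have -> : \sum_(y \in lower_desc s w) (c y *~ mu y w) =
    \sum_(y \in below w) (if `[< Desc y s >] then c y *~ mu y w else 0).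
  rewrite (eq_fsbigr (fun y => if `[< Desc y s >] then c y *~ mu y w else 0)).
    apply: fsbig_widen; first exact: lower_desc_below.
    by move=> y [[Iy yw] n] /=; rewrite asboolF// => Dy; apply: n.
  by move=> y /set_mem[_ _ Dy]; rewrite asboolT.
rewrite [X in T s *: X]fsbig_finite// scaler_sumr -fsbig_finite//=.
rewrite [X in lq *' X]fsbig_finite// ascale_sum -fsbig_finite//=.
rewrite [X in _ - X]fsbig_finite// -sumrN -fsbig_finite// -!fsbig_split//=.
apply: lspan_sum => y yw; have [Iy yltw] := yw.
have yz : below (s * w)%g y by exact: below_trans yw.
rewrite scale_ascale (hF y yw).
case: asboolP => [Dy|nD]; last first.
  rewrite addr0 ascaleDr !ascaleA [lq * (_ * _)]mulrC addrAC subrr add0r.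
  apply: lspan_scale (mu_part_lspan wz yw Ss) => x hx.
  by apply: lqZqM => //; exact: lqZq_lpoly.
rewrite -ascaleNl !ascaleA -ascale_mulrz -ascaleBl -ascaleDl; apply: lspan1 => //.
have -> : lq * lpoly (Q y w) * - lqV - lq * (lq * lpoly (Q y w)) + (mu y w)%:~R =
    - lpoly (Q y w - ((Q y w)`_0)%:P) - lq * lpoly ('X * Q y w).
  rewrite (rmorphB lpoly) (rmorphM lpoly) /= lpolyC -/lq mulrN [lq * lpoly _]mulrC -mulrA lqKV mulr1.
  by rewrite opprB /muQ; ring.
have [_ B _] := nu_subring_lqZq; apply: B; last exact: lqZq_lpoly.
by apply: nu_subringN nu_subring_lqZq _ _; exact: lqZq_lpolyX.
Qed.

End Action.
End IdealCombinatorics.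

(** * Symmetric edge weights *)

Section TheGraph.
Variables (W : groupType) (S : set W) (hWS : coxeter_system S).
Variables (I J : set W) (hI : left_ideal S I) (hJ : J `<=` Pos S I).
Variable Q : W -> W -> {poly int}.
Local Notation blt := (bruhat_lt S).
Local Notation SA := (SA S I).
Local Notation Desc := (Desc S J).
Local Notation Asc := (Asc S I J).
Local Notation mu := (muQ Q).
Local Notation G := (@graph_of W S I J Q).

(** In the W-graph mu is symmetric, so the edge between v < u also leads from v upwards; the
    formulas for the action know only one such edge, from v to sv. Hence mu_(v,u) must be
    trivial when s is in D(u) but not in D(v) and u is different from sv. *)
Definition top_mu : Prop := forall v u s, I v -> I u -> blt v u -> Desc u s -> Asc v s ->
  mu v u = if u == (s * v)%g then 1 else 0.

Hypothesis htop : top_mu.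

Lemma graph_sum (M : lmodType (hecke S)) (c : W -> M) s v : I v -> Asc v s ->
  let N := [set u | I u /\ Desc u s] in
  finite_set [set u | N u /\ gmu G u v <> 0] /\
  \sum_(u \in N) (c u *~ gmu G u v) = mu_part I J Q c s v.
Proof.
move=> Iv Av N; have [Ss vsv] := AscP Av.
pose L := lower_desc S I J s v; pose top := [set u | u = (s * v)%g /\ SA v s].
have gmu0 u : N u -> ~ (L `|` top) u -> gmu G u v = 0.
  move=> [Iu Du] nF /=; case: asboolP => uv; first by case: nF; left.
  case: asboolP => // vu; rewrite (htop Iv Iu vu Du Av); have [usv|//] := eqVneq u (s * v)%g.
  by case: nF; right; split=> //; split=> //; rewrite -usv.
have Lf : finite_set L by exact: finite_lower_desc.
have topf : finite_set top by apply: (@sub_finite_set _ _ [set (s * v)%g]) => // u [].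
have LtopN : L `|` top `<=` N.
  by move=> u [[Iu _ Du]|[-> SAv]]; split=> //; [case: SAv|left; apply: SA_SD SAv].
split.
  apply: (@sub_finite_set _ _ (L `|` top)); last by rewrite finite_setU.
  by move=> u [Nu gu]; apply: contrapT => /(gmu0 u Nu).
have -> : \sum_(u \in N) (c u *~ gmu G u v) = \sum_(u \in L `|` top) (c u *~ gmu G u v).
  apply/esym/fsbig_widen => // u [Nu nF] /=.
  by rewrite [X in _ *~ X](gmu0 u Nu nF) mulr0z.
rewrite fsbigU0//; last first.
  by move=> u [[_ uv _] [uE _]]; rewrite uE in uv; exact: blt_irr (blt_trans uv vsv).
rewrite /= addrC /mu_part; congr (_ + _).
  case: asboolP => [SAv|nSA]; last by rewrite fsbig1// => u [].
  have Isv : I (s * v)%g by case: SAv.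
  have Dsv : Desc (s * v)%g s by left; exact: SA_SD SAv.
  rewrite (@fsum_only _ _ top (s * v)%g)//; last by move=> u [].
  rewrite /= asboolF; last by move=> h; exact: blt_irr (blt_trans h vsv).
  by rewrite asboolT// (htop Iv Isv vsv Dsv Av) eqxx.
by apply: eq_fsbigr => u /set_mem[_ uv _] /=; rewrite asboolT.
Qed.

(** Under [top_mu] the sum over all vertices with s in their label reduces to [mu_part]. *)
Lemma graph_module_act (M : lmodType (hecke S)) (c : W -> M) :
  graph_module G c <-> is_basis I c /\
    forall s w, S s -> I w -> act_formula I J Q c s w.
Proof.
split=> -[hc h]; split=> // s w Ss Iw; last first.
  have {}h := h s w Ss Iw; rewrite /act_formula in h; split=> [D|nD].
    by rewrite h asboolT.
  have [f sumE] := graph_sum c Iw (not_Desc_Asc hWS I Ss nD); split=> //.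
  by rewrite h asboolF// sumE.
have [hD hA] := h s w Ss Iw; rewrite /act_formula; case: asboolP => [/hD//|nD].
have [f ->] := hA nD; have [_ /= sumE] := graph_sum c Iw (not_Desc_Asc hWS I Ss nD).
by rewrite sumE.
Qed.

End TheGraph.

(** * The bar-invariant basis of a W-graph ideal *)

Section BarInvariant.
Variables (W : groupType) (S : set W) (hWS : coxeter_system S).
Variables (I J : set W) (hI : left_ideal S I) (hJ : J `<=` Pos S I).
Variables (M : lmodType (hecke S)) (b : W -> M) (bar : M -> M).
Hypothesis hideal : ideal_basis I J b.
Hypothesis hbar_b : ideal_bar b bar.
Local Notation len := (len S).
Local Notation blt := (bruhat_lt S).
Local Notation SD := (SD S).
Local Notation SA := (SA S I).
Local Notation WD := (WD S J).
Local Notation WA := (WA S I J).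
Local Notation Desc := (Desc S J).
Local Notation Asc := (Asc S I J).
Local Notation below := (below S I).
Local Notation "a *' m" := (@ascale W S _ a m) (at level 40, left associativity).
Local Notation T := (hT S).

Let hb : is_basis I b := hideal.1.

Lemma barD x y : bar (x + y) = bar x + bar y. Proof. by case: hbar_b. Qed.
Lemma barZ a x : bar (a *' x) = lbar a *' bar x. Proof. by case: hbar_b. Qed.
Lemma bar0 : bar 0 = 0. Proof. by have := barZ 0 0; rewrite rmorph0 !ascale0. Qed.
Lemma barN x : bar (- x) = - bar x.
Proof. by apply/eqP; rewrite -addr_eq0 -barD addNr bar0 eqxx. Qed.
Lemma barB x y : bar (x - y) = bar x - bar y. Proof. by rewrite barD barN. Qed.

Lemma barT s x : S s -> bar (T s *: x) = T s *: bar x - (lq - lqV) *' bar x.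
Proof. by move=> Ss; case: hbar_b => _ _ _ _ ->; rewrite hbarT// scalerBl. Qed.

(** T_s - q equals T_s^-1 - q^-1, hence commutes with the bar involution. *)
Lemma bar_fixed_sub s x : S s -> bar x = x ->
  bar (T s *: x - lq *' x) = T s *: x - lq *' x.
Proof.
move=> Ss xx; rewrite barB barT// barZ lbarq xx ascaleBl opprB.
by rewrite addrA addrAC addrK.
Qed.

(** T_s + q^-1 equals T_s^-1 + q, hence commutes with the bar involution. *)
Lemma bar_fixed_add s x : S s -> bar x = x ->
  bar (T s *: x + lqV *' x) = T s *: x + lqV *' x.
Proof.
move=> Ss xx; rewrite barD barT// barZ lbarqV xx ascaleBl opprB.
by rewrite addrA subrK.
Qed.

Lemma bar_fixedZ (k : int) x : bar x = x -> bar (x *~ k) = x *~ k.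
Proof. by move=> xx; rewrite -ascale_mulrz barZ lbarz xx. Qed.

(** T_s - q may introduce q^-1 at descents, but only once; the factor q in the coefficients
    of m absorbs it. *)
Lemma act_lower s w m : S s -> blt w (s * w)%g -> lspan lqZq (below w) b m ->
  lspan polyA (below (s * w)%g) b (T s *: m - lq *' m).
Proof.
move=> Ss wz; have [_ hB] := hideal.
elim=> [|_ u n [p _ <-] [Iu uw] _ IH]; first by rewrite scaler0 ascaler0 subr0; exact: lspan0.
rewrite scalerDr ascaleDr opprD addrACA; apply: lspanD => //.
have uz : blt u (s * w)%g by exact: blt_trans wz.
have suz : blt (s * u)%g (s * w)%g by exact: blt_mul_asc.
have polyA_ideal a : polyA a -> forall x, polyA x -> polyA (a * x).
  by move=> Pa x; have [_ _ PM] := nu_subring_polyA; exact: PM.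
have single a y : polyA a -> below (s * w)%g y -> lspan polyA (below (s * w)%g) b (a *' b y).
  by move=> Pa yz; exact: lspan1.
have Pq : polyA lq by exact: polyA_lpoly.
have P1 : polyA 1 by rewrite -[1](rmorph1 lpoly); exact: polyA_lpoly.
have zu : below (s * w)%g u by [].
suff h : lspan polyA (below (s * w)%g) b (lq *' (T s *: b u - lq *' b u)).
  have e : lq *' ((lq * lpoly p) *' b u) = (lq * lpoly p) *' (lq *' b u).
    by rewrite !ascaleA mulrC.
  rewrite scale_ascale e -ascaleBr mulrC -ascaleA.
  by apply: lspan_scale h; apply: polyA_ideal; exact: polyA_lpoly.
have [hSA hSD hWD hWA] := hB s u Iu.
rewrite ascaleBr !ascaleA.
have [[SDu|WDu]|/(not_Desc_Asc hWS I Ss) [SAu|WAu]] := pselect (Desc u s).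
- rewrite hSD// ascaleDr !ascaleA -addrA -ascaleBl; apply: lspanD.
    by apply: single => //; split=> //; exact: (SD_ideal hWS hI Iu SDu).
  apply: single => //; rewrite mulrBr lqKV addrAC subrr sub0r.
  exact: (nu_subringN nu_subring_polyA P1).
- rewrite hWD// ascaleNr !ascaleA lqKV ascale1 -opprD; apply: (lspanN nu_subring_polyA).
  rewrite -[b u in X in X + _]ascale1 -ascaleDl; apply: single => //.
  by apply: (nu_subringD nu_subring_polyA P1); exact: polyA_ideal.
- rewrite hSA//; apply: (lspanB nu_subring_polyA).
    by apply: single => //; split=> //; case: SAu.
  by apply: single => //; exact: polyA_ideal.
- have [r [hr ->]] := hWA WAu.
  rewrite ascaleBr ascaleA addrAC subrr sub0r; apply: (lspanN nu_subring_polyA).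
  rewrite fsbig_finite/=; last exact: finite_below.
  rewrite ascale_sum -fsbig_finite/=; last exact: finite_below.
  apply: lspan_sum => y [Iy yu]; rewrite ascaleA; apply: single.
    by have [r' _ <-] := hr y Iy yu; rewrite -!rmorphM; exact: polyA_lpoly.
  by split=> //; exact: blt_trans suz.
Qed.

(** The constant terms of the coefficients of e are integers, hence fixed by the bar
    involution: e' is the same integral combination of bar-invariant elements congruent to
    the b_y. *)
Lemma integral_part w e :
  (forall y, below w y -> exists x, bar x = x /\ lspan lqZq (below y) b (x - b y)) ->
  lspan polyA (below w) b e ->
  exists e', bar e' = e' /\ lspan lqZq (below w) b (e - e').
Proof.
move=> IH; elim=> [|_ u n [p _ <-] uw _ [n' [n'fix nn']]].
  by exists 0; rewrite bar0 subr0; split=> //; exact: lspan0.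
have [x [xfix hx]] := IH u uw; exists (x *~ p`_0 + n').
split; first by rewrite barD bar_fixedZ// n'fix.
rewrite opprD addrACA; apply: lspanD => //.
have -> : lpoly p *' b u - x *~ p`_0 =
    lpoly (p - (p`_0)%:P) *' b u - (p`_0)%:~R *' (x - b u).
  by rewrite (rmorphB lpoly) /= lpolyC ascaleBl ascaleBr !ascale_mulrz opprB addrA subrK.
apply: (lspanB nu_subring_lqZq); first by apply: lspan1 => //; exact: lqZq_lpolyX.
apply: (@lspan_scale _ _ _ _ _ _ _ lqZq) => [a ha|].
  by rewrite mulrC -lpolyC; apply: lqZqM => //; exact: polyA_lpoly.
by case: uw => _ uw; apply: (lspanS hx) => //; exact: below_trans.
Qed.

(** For w = sv the element T_s x - q x, with x the bar-invariant element for v, is bar-invariant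
    and equals b_w up to lower terms over Z[q]. A bar-invariant correction makes these
    lower terms divisible by q. *)
Lemma bar_invariant_exists w : I w ->
  exists x, bar x = x /\ lspan lqZq (below w) b (x - b w).
Proof.
elim/(@len_ind W S): w => w IH Iw.
have [->|w1] := pselect (w = 1%g).
  exists (b 1%g); rewrite subrr; split; last exact: lspan0.
  by case: hbar_b.
have [s Ss lsw] := descent_exists hWS w1; set v := (s * w)%g in lsw.
have svw : (s * v)%g = w by rewrite /v (genK hWS).
have vw : blt v w by apply/(blt_gen_descP hWS).
have Iv : I v by exact: (ideal_desc hWS hI).
have SAv : SA v s by split; rewrite ?svw.
have [x [xfix hx]] := IH v lsw Iv; set y := T s *: x - lq *' x.
have [|e' [e'fix he']] := @integral_part w (y - b w) (fun z zw => IH z (blt_len zw.2) zw.1).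
  have -> : y - b w = T s *: (x - b v) - lq *' (x - b v) - lq *' b v.
    have [_ /(_ s v Iv)[/(_ SAv) Tv _ _ _]] := hideal.
    rewrite svw in Tv; rewrite scalerBr ascaleBr Tv /y opprB.
    by rewrite addrA [RHS]addrAC addrK addrAC.
  apply: (lspanB nu_subring_polyA).
    by rewrite -svw; apply: act_lower; rewrite ?svw.
  by apply: lspan1; [exact: polyA_lpoly|split].
exists (y - e'); split; first by rewrite barB e'fix bar_fixed_sub.
by rewrite addrAC.
Qed.

Section Formulas.
Variable c : W -> M.
Hypothesis c_fixed : forall w, I w -> bar (c w) = c w.
Hypothesis c_tri : forall w, I w -> lspan lqZq (below w) b (c w - b w).

Lemma fixed_basis : is_basis I c.
Proof.
by apply: (unitri_basis hb) => w Iw; apply: (lspanS (c_tri Iw)).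
Qed.

Local Notation coord := (coord fixed_basis).

Lemma fixed_tri w : I w -> lspan lqZq (below w) c (b w - c w).
Proof. exact: (unitri_inv nu_subring_lqZq c_tri). Qed.

(** The analogue of the Kazhdan-Lusztig polynomials: q q_(y,w) is the coordinate of
    b_w - c_w at c_y. *)
Definition kl_poly (y w : W) : {poly int} :=
  xget 0 [set p | coord (b w - c w) y = lq * lpoly p].

Lemma kl_polyP y w : I w -> coord (b w - c w) y = lq * lpoly (kl_poly y w).
Proof.
move=> Iw; have [[p _ e] _] :=
  lspan_coord fixed_basis y nu_subring_lqZq (@below_sub _ _ _ w) (fixed_tri Iw).
exact: (@xgetPex _ 0 [set p | coord (b w - c w) y = lq * lpoly p] (ex_intro _ p (esym e))).
Qed.

Lemma kl_poly0 y w : I w -> ~ below w y -> kl_poly y w = 0.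
Proof.
move=> Iw nyw; apply: lpoly_inj; apply: lqI; rewrite -kl_polyP// (rmorph0 lpoly) mulr0.
have [_ h] := lspan_coord fixed_basis y nu_subring_lqZq (@below_sub _ _ _ w) (fixed_tri Iw).
by apply: contrapT => /h.
Qed.

Lemma kl_poly_out y w : I y -> I w -> ~ blt y w -> kl_poly y w = 0.
Proof. by move=> _ Iw nyw; apply: kl_poly0 => // -[]. Qed.

Local Notation Q := kl_poly.
Local Notation mu := (muQ Q).
Local Notation formula := (act_formula I J Q c).

Lemma std_elt_kl w : I w -> std_elt I Q c w = b w.
Proof.
move=> Iw; apply: (coord_inj (hb := fixed_basis)) => y Iy.
rewrite (coord_std_elt hWS _ kl_poly_out)// -kl_polyP// coordB [X in _ - X]coord_basis//.
by rewrite addrC subrK.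
Qed.

Lemma coord_bar m u : I u -> coord (bar m) u = lbar (coord m u).
Proof.
move=> Iu; elim: (lspan_setT fixed_basis m) => [|a v n _ Iv _ IH].
  by rewrite bar0 !coord0 rmorph0.
rewrite barD barZ c_fixed// !coordD !coordZ IH rmorphD rmorphM /= coord_basis//.
by case: (u == v); rewrite ?rmorph1 ?rmorph0.
Qed.

(** Equality of bar-invariant elements can therefore be tested modulo q. *)
Lemma bar_fixed_eq0 m : bar m = m -> lspan lqZq I c m -> m = 0.
Proof.
move=> mfix hm; apply: (coord_inj (hb := fixed_basis)) => u Iu; rewrite coord0.
apply: lbar_fixed_lqZq; last by rewrite -coord_bar// mfix.
by have [] := lspan_coord fixed_basis u nu_subring_lqZq (fun x => id) hm.
Qed.

Lemma bar_mu_part s w : I w -> bar (mu_part I J Q c s w) = mu_part I J Q c s w.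
Proof.
move=> Iw; rewrite /mu_part barD; congr (_ + _).
  by case: asboolP => [[_ _ /c_fixed]//|_]; exact: bar0.
apply: (@fsum_ind M W _ _ (fun x => bar x = x)); first exact: bar0.
  by move=> x y xx yy; rewrite barD xx yy.
by move=> y [Iy _ _]; apply: bar_fixedZ; exact: c_fixed.
Qed.

Lemma b_lspan w : I w -> lspan polyA I c (b w).
Proof.
move=> Iw; rewrite -[b w](subrK (c w)); apply: lspanD.
  apply: (lspanS (fixed_tri Iw)); last exact: below_sub.
  by move=> _ [p _ <-]; rewrite -rmorphM; exact: polyA_lpoly.
rewrite -[c w]ascale1 -[1](rmorph1 lpoly); apply: lspan1 => //; exact: polyA_lpoly.
Qed.

(** Both sides are bar-invariant, and they are congruent modulo q: T_s b_w - q b_w is b_sw or 0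
    modulo q according to the kind of ascent, and the difference between b_w and c_w is
    controlled by [act_std_elt_lower]. *)
Lemma formula_asc s w : I w -> Asc w s -> (forall y, below w y -> formula s y) -> formula s w.
Proof.
move=> Iw Aw IH; have [Ss wz] := AscP Aw.
rewrite /act_formula asboolF; last exact: (Asc_not_Desc hJ Aw).
have qL m : lspan polyA I c m -> lspan lqZq I c (lq *' m).
  by apply: lspan_scale => _ [p _ <-]; exact: lqZq_lpoly.
apply/eqP; rewrite addrC -subr_eq -subr_eq0; apply/eqP.
apply: bar_fixed_eq0.
  by rewrite barB bar_fixed_sub ?c_fixed// bar_mu_part.
have low := act_std_elt_lower hWS Ss wz IH.
rewrite std_elt_kl// in low.
set top := if `[< SA w s >] then c (s * w)%g else 0.
set R := \sum_(y \in _) _ in low.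
have -> : T s *: c w - lq *' c w - mu_part I J Q c s w =
   (T s *: b w - top - lq *' b w) - (T s *: (b w - c w) - lq *' (b w - c w) + R).
  apply/esym/eqP; rewrite subr_eq /mu_part -/top -/R scalerBr ascaleBr; apply/eqP.
  rewrite addrACA [- (top + _)]opprD subrK opprB addrA [_ - lq *' c w + _]addrC !subrKA.
  by rewrite addrAC.
apply: (lspanB nu_subring_lqZq); last by apply: (lspanS low) => //; exact: below_sub.
have [_ /(_ s w Iw)[hSA _ _ hWA]] := hideal.
case: Aw => [SAw|WAw].
  have Iz : I (s * w)%g by case: SAw.
  rewrite /top asboolT// hSA//; apply: (lspanB nu_subring_lqZq).
    by apply: (lspanS (fixed_tri Iz)) => //; exact: below_sub.
  by apply: qL; exact: b_lspan.
rewrite /top asboolF; last exact: WA_not_SA WAw.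
have [r [hr ->]] := hWA WAw.
rewrite subr0 addrAC subrr sub0r; apply: (lspanN nu_subring_lqZq).
apply: lspan_sum => y [Iy yz]; apply: lspan_scale (b_lspan Iy) => x hx.
by apply: lqZqM => //; exact: hr.
Qed.

Lemma act_desc_span (X : set W) s m : S s -> (forall y, X y -> Desc y s /\ formula s y) ->
  lspan setT X c m -> T s *: m = - (lqV *' m).
Proof.
move=> Ss hX; elim=> [|a y n _ /hX[Dy fy] _ IH]; first by rewrite scaler0 ascaler0 oppr0.
rewrite scalerDr IH scale_ascale fy asboolT// ascaleDr opprD ascaleNr; congr (- _ + _).
by rewrite !ascaleA mulrC.
Qed.

(** Here (T_s + q^-1) b_w = 0. At an ascent u the coordinate of this equation says that
    (q + q^-1) q q_(u,w) is fixed by the bar involution, hence so is q q_(u,w), which is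
    then zero. So b_w - c_w only involves vertices on which T_s acts by -q^-1, and T_s acts
    by -q^-1 on c_w as well. *)
Lemma formula_wd s w : I w -> WD w s -> (forall y, below w y -> formula s y) -> formula s w.
Proof.
move=> Iw WDw IH; have Dw : Desc w s by right.
have Ss := Desc_gen Dw; rewrite /act_formula asboolT//.
set m := b w - c w; have hm : lspan lqZq (below w) c m by exact: fixed_tri.
have [_ /(_ s w Iw)[_ _ /(_ WDw) Tb _]] := hideal.
have e : T s *: c w + lqV *' c w = - (T s *: m + lqV *' m).
  by rewrite /m scalerBr ascaleBr Tb addrACA addNr add0r opprD !opprK.
(* [m] has no coordinates at vertices with s as an ascent. *)
have k0 u : I u -> Asc u s -> coord m u = 0.
  move=> Iu Au; have hu : coord (T s *: c w + lqV *' c w) u = - ((lq + lqV) * coord m u).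
    rewrite e coordN coordD coordZ (coord_act_at_asc hWS hJ fixed_basis (Q := Q) (X := below w))//.
    - by rewrite mulrDl.
    - by move=> x xw; split; [case: xw|exact: IH].
    - by apply: (lspanS hm).
  have [kq _] := lspan_coord fixed_basis u nu_subring_lqZq (@below_sub _ _ _ w) hm.
  apply: lbar_fixed_lqZq => //; apply/eqP; rewrite -subr_eq0; apply/eqP; apply: lqDlqVI.
  have := coord_bar (T s *: c w + lqV *' c w) Iu.
  rewrite bar_fixed_add ?c_fixed// hu rmorphN rmorphM rmorphD /= lbarq lbarqV.
  by rewrite mulrBr [lqV + lq]addrC => /oppr_inj <-; rewrite subrr.
have hm' : lspan setT [set u | below w u /\ Desc u s] c m.
  apply: (coord_lspan (hb := fixed_basis)) => u Iu ku; split=> //; split.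
    by have [_] := lspan_coord fixed_basis u nu_subring_lqZq (@below_sub _ _ _ w) hm; apply.
  by apply: contrapT => nD; apply: ku; apply: k0 => //; exact: not_Desc_Asc.
have : T s *: c w + lqV *' c w = 0.
  rewrite e (act_desc_span Ss _ hm') ?addNr ?oppr0// => u [uw Du].
  by split=> //; exact: IH.
by move/eqP; rewrite addr_eq0 => /eqP.
Qed.

(** For w = sv the formula at v expresses c_w as (T_s - q) c_v minus lower vertices with s in
    their label; T_s + q^-1 kills both by the quadratic relation and by induction. *)
Lemma formula_sd s w : I w -> SD w s ->
  (forall y, I y -> blt y w -> formula s y) -> formula s w.
Proof.
move=> Iw SDw IH; have Dw : Desc w s by left.
have Ss := Desc_gen Dw; rewrite /act_formula asboolT//.
set v := (s * w)%g; have svw : (s * v)%g = w by rewrite /v (genK hWS).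
have vw : blt v w by case: SDw.
have Iv : I v by exact: (SD_ideal hWS hI Iw SDw).
have SAv : SA v s by exact: (SD_SA hWS Iw SDw).
have := IH v Iv vw; rewrite /act_formula asboolF; last exact: (SA_not_Desc hJ SAv).
rewrite /mu_part asboolT// svw; set R := \sum_(y \in _) _ => Tv.
have TR : T s *: R = - (lqV *' R).
  apply: (@act_desc_span (lower_desc S I J s v)) => //.
    by move=> y [Iy yv Dy]; split=> //; apply: IH => //; exact: blt_trans vw.
  by apply: lspan_sum => y hy; rewrite -ascale_mulrz; exact: lspan1.
have cw : c w = T s *: c v - lq *' c v - R by rewrite Tv [lq *' _ + _]addrC !addrK.
have TT : T s *: (T s *: c v) = c v + (lq - lqV) *' (T s *: c v).
  by rewrite scalerA hT_quad// scalerDl scale1r /ascale scalerA -scalerAl mul1r.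
rewrite cw !scalerBr TT scale_ascale TR !ascaleBr ascaleA lqVK ascale1 ascaleBl !opprB opprK.
by rewrite [lq *' _ - _]addrC addrA addrK [LHS]addrC.
Qed.

Lemma formulas s w : S s -> I w -> formula s w.
Proof.
move=> Ss; elim/(@len_ind W S): w => w IH Iw.
have IH' y : below w y -> formula s y by move=> [Iy /blt_len yw]; exact: IH.
have [[SDw|WDw]|/(not_Desc_Asc hWS I Ss) Aw] := pselect (Desc w s).
- by apply: formula_sd => // y Iy yw; exact: IH'.
- exact: formula_wd.
- exact: formula_asc.
Qed.

(** Read at the ascent v, the equation T_s b_su = b_u gives q_(v,u) = q q_(v,su), which has no
    constant term, unless v = su, when it gives q_(v,u) = 1. If s is a weak descent of u
    then the equation T_s b_u = -q^-1 b_u gives q_(v,u) = 0. *)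
Lemma kl_top_mu : top_mu S I J Q.
Proof.
move=> v u s Iv Iu vu Du Av; have Ss := Desc_gen Du.
have hF := formulas.
have vuE : (v == u) = false by apply/eqP => e; rewrite e in vu; exact: blt_irr vu.
have cu : coord (b u) v = lq * lpoly (Q v u).
  by rewrite -std_elt_kl// (coord_std_elt hWS _ kl_poly_out)// vuE add0r.
have [_ hB] := hideal.
case: Du => [SDu|WDu].
  have Iw := SD_ideal hWS hI Iu SDu; have SAw := SD_SA hWS Iu SDu.
  set w := (s * u)%g in Iw SAw; have swu : (s * w)%g = u by rewrite /w (genK hWS).
  have [/(_ SAw) Tb _ _ _] := hB s w Iw; rewrite swu -std_elt_kl// in Tb.
  have := coord_act_std_elt_asc hWS hJ fixed_basis hF w Iv Av.
  rewrite Tb cu (coord_std_elt hWS _ kl_poly_out)// => /lqI QE.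
  have -> : (u == s * v)%g = (v == w).
    by apply/eqP/eqP => [e|->]; rewrite /w ?e (genK hWS).
  rewrite /muQ; have [vw|vw] := eqVneq v w.
    have Qvw : Q v w = 0 by apply: kl_poly_out => //; rewrite vw; exact: blt_irr.
    move: QE; rewrite Qvw vw eqxx (rmorph0 lpoly) mulr0 addr0 -[1%:R](rmorph1 lpoly) => /lpoly_inj->.
    by rewrite coef1.
  move: QE; rewrite (negbTE vw) add0r -rmorphM => /lpoly_inj->.
  by rewrite coefXM.
have [_ _ /(_ WDu) Tb _] := hB s u Iu.
have := coord_act_std_elt_asc hWS hJ fixed_basis hF u Iv Av.
rewrite std_elt_kl// Tb -ascaleNl coordZ cu => /eqP.
rewrite eq_sym -subr_eq0 mulNr opprK -mulrDl => /eqP/lqDlqVI e.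
have Q0 : Q v u = 0 by apply: lpoly_inj; apply: lqI; rewrite e (rmorph0 lpoly) mulr0.
rewrite /muQ Q0 coef0; have [usv|//] := eqVneq u (s * v)%g.
case: WDu => _ uv _; rewrite {2}usv (genK hWS)// in uv.
by case: (blt_irr (blt_trans uv vu)).
Qed.

End Formulas.
End BarInvariant.

(** * The equivalence *)

Section Directions.
Variables (W : groupType) (S : set W) (hWS : coxeter_system S).
Variables (I J : set W) (hI : left_ideal S I) (hJ : J `<=` Pos S I).
Local Notation len := (len S).
Local Notation blt := (bruhat_lt S).
Local Notation SD := (SD S).
Local Notation SA := (SA S I).
Local Notation WD := (WD S J).
Local Notation WA := (WA S I J).
Local Notation Desc := (Desc S J).
Local Notation Asc := (Asc S I J).
Local Notation below := (below S I).
Local Notation T := (hT S).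

Lemma choice_descent ch z : valid_choice S I ch -> I z -> z <> 1%g ->
  [/\ S (ch z), I (ch z * z)%g & SA (ch z * z)%g (ch z)].
Proof.
move=> hch Iz z1; have [Ss l] := hch z Iz z1.
have SDz : SD z (ch z) by split=> //; exact/(blt_gen_descP hWS).
by split; [|exact: (SD_ideal hWS hI)|exact: (SD_SA hWS)].
Qed.

Lemma constructionP Q ch : valid_choice S I ch ->
  construction S I J Q ch <->
  (forall y w, I y -> I w -> ~ blt y w -> Q y w = 0) /\
  (forall z, I z -> z <> 1%g -> recursion S I J Q (ch z) (ch z * z)%g).
Proof.
move=> hch; split=> -[Q0 h]; split=> // z Iz z1; have [Ss _ _] := choice_descent hch Iz z1;
  by have := h z Iz z1; rewrite /recursion (genK hWS).
Qed.

Lemma valid_choice_exists : exists ch, valid_choice S I ch.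
Proof.
have /choice[ch hch] : forall z, exists s, z <> 1%g -> S s /\ (len (s * z)%g < len z)%N.
  move=> z; have [->|z1] := pselect (z = 1%g); first by exists 1%g.
  by have [s Ss l] := descent_exists hWS z1; exists s.
by exists ch => z _; exact: hch.
Qed.

(** All choices of descents work, as T_s b_sz = b_z holds for every one of them. *)
Lemma ideal_produces_graph : Wgraph_ideal S I J -> construction_produces_Wgraph S I J.
Proof.
move=> [M [b [hideal [bar hbar]]]].
have /choice[c hc] : forall w, exists x, I w ->
    bar x = x /\ lspan lqZq (below w) b (x - b w).
  move=> w; have [Iw|nI] := pselect (I w); last by exists 0.
  by have [x hx] := bar_invariant_exists hWS hI hideal hbar Iw; exists x.
have c_fixed w : I w -> bar (c w) = c w by move=> /hc[].
have c_tri w : I w -> lspan lqZq (below w) b (c w - b w) by move=> /hc[].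
have hF := formulas hWS hI hJ hideal hbar c_fixed c_tri.
have Q0 := @kl_poly_out _ _ _ _ _ _ hideal _ c_tri.
have Qtop := kl_top_mu hWS hI hJ hideal hbar c_fixed c_tri.
have Qb := @std_elt_kl _ _ hWS _ _ _ _ hideal _ c_tri.
have cbasis := fixed_basis hideal c_tri.
move: (kl_poly _ _) hF Q0 Qtop Qb => Q hF Q0 Qtop Qb.
have [ch hch] := valid_choice_exists.
exists ch, Q; split=> //.
- apply/constructionP => //; split=> // z Iz z1.
  have [Ss Iw SAw] := choice_descent hch Iz z1.
  apply/(recursionP hWS hI hJ cbasis Q0 hF Iw SAw).
  have [_ /(_ (ch z) _ Iw)[/(_ SAw) Tb _ _ _]] := hideal.
  by rewrite !Qb// (genK hWS).
- split; first by move=> v Iv s; exact: Desc_gen.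
  exists M, c; exact: (graph_module_act hWS Qtop c).2 (conj cbasis hF).
- move=> M' c' hM; have [_ h] := (graph_module_act hWS Qtop c').1 hM.
  exact/(graph_formulasP hWS hJ).
Qed.

(** * From the W-graph to the ideal *)

Section Backward.
Variables (M : lmodType (hecke S)) (Q : W -> W -> {poly int}) (c : W -> M).
Local Notation "a *' m" := (@ascale W S _ a m) (at level 40, left associativity).
Hypothesis hc : is_basis I c.
Hypothesis hF : forall s w, S s -> I w -> act_formula I J Q c s w.
Hypothesis Q0 : forall y w, I y -> I w -> ~ blt y w -> Q y w = 0.
Local Notation ccoord := (coord hc).
Local Notation b := (std_elt I Q c).

Definition graph_bar (m : M) : M := \sum_(u \in I) (lbar (ccoord m u) *' c u).

Lemma coord_graph_bar m u : ccoord (graph_bar m) u = lbar (ccoord m u).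
Proof.
have sub : [set u | lbar (ccoord m u) <> 0] `<=` [set u | ccoord m u <> 0].
  by move=> v /= h e; apply: h; rewrite e rmorph0.
have [fm mI _] := coordP hc m.
rewrite (@coord_uniq _ _ _ _ _ _ hc (graph_bar m) (fun u => lbar (ccoord m u)))//.
- exact: sub_finite_set fm.
- exact: subset_trans mI.
Qed.

Lemma graph_barD : {morph graph_bar : x y / x + y}.
Proof.
move=> x y; apply: (coord_inj (hb := hc)) => u _.
by rewrite !(coordD, coord_graph_bar) rmorphD.
Qed.

Lemma graph_barZ a x : graph_bar (a *' x) = lbar a *' graph_bar x.
Proof.
apply: (coord_inj (hb := hc)) => u _.
by rewrite !(coordZ, coord_graph_bar) rmorphM.
Qed.

Lemma graph_barK : involutive graph_bar.
Proof. by move=> x; apply: (coord_inj (hb := hc)) => u _; rewrite !coord_graph_bar lbarK. Qed.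

Lemma graph_bar_basis w : I w -> graph_bar (c w) = c w.
Proof.
move=> Iw; apply: (coord_inj (hb := hc)) => u _; rewrite coord_graph_bar coord_basis//.
by case: eqP; rewrite ?rmorph1 ?rmorph0.
Qed.

Lemma graph_bar0 : graph_bar 0 = 0.
Proof. by apply: (addrI (graph_bar 0)); rewrite -graph_barD !addr0. Qed.

Lemma graph_barN x : graph_bar (- x) = - graph_bar x.
Proof. by apply: (addrI (graph_bar x)); rewrite -graph_barD !subrr graph_bar0. Qed.

Lemma graph_bar_mu_part s w : graph_bar (mu_part I J Q c s w) = mu_part I J Q c s w.
Proof.
rewrite /mu_part graph_barD; congr (_ + _).
  by case: asboolP => [[_ _ /graph_bar_basis]//|_]; exact: graph_bar0.
apply: (@fsum_ind M W _ _ (fun x => graph_bar x = x)); first exact: graph_bar0.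
  by move=> x y xx yy; rewrite graph_barD xx yy.
by move=> y [Iy _ _]; rewrite -ascale_mulrz graph_barZ lbarz graph_bar_basis.
Qed.

(** On a vertex T_s acts by q, -q^-1 and integers; the bar involution exchanges q with
    q^-1, which is the effect of subtracting q - q^-1. *)
Lemma graph_barT s x : S s -> graph_bar (T s *: x) = hbar (T s) *: graph_bar x.
Proof.
move=> Ss; rewrite hbarT// scalerBl -/(ascale _ _).
elim: (lspan_setT hc x) => [|a w n _ Iw _ IH].
  by rewrite !(scaler0, graph_bar0) ascaler0 subr0.
rewrite scalerDr !graph_barD IH scalerDr ascaleDr opprD addrACA; congr (_ + _).
have e : (lq - lqV) *' (lbar a *' c w) = lbar a *' ((lq - lqV) *' c w).
  by rewrite !ascaleA mulrC.
rewrite scale_ascale !graph_barZ graph_bar_basis// scale_ascale [X in _ - X]e -ascaleBr.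
congr (_ *' _); have := hF Ss Iw; rewrite /act_formula => ->.
case: asboolP => _.
  by rewrite graph_barN graph_barZ lbarqV graph_bar_basis// ascaleBl opprB addKr.
rewrite graph_barD graph_barZ lbarq graph_bar_basis// graph_bar_mu_part ascaleBl opprB.
by rewrite [RHS]addrC subrKA.
Qed.

Lemma graph_barH h x : graph_bar (h *: x) = hbar h *: graph_bar x.
Proof.
move: h x; elim/hclass_surj; elim=> [a|s|h IHh k IHk|h IHh k IHk] x.
- rewrite -[hclass _ _]/(hscal S a) hscalE hbar_scal; exact: graph_barZ.
- rewrite -[hclass _ _]/(T s); have [Ss|nS] := pselect (S s); first exact: graph_barT.
  have h0 : hbar (0 : hecke S) = 0.
    by have := hbar_scal S 0; rewrite rmorph0 scale0r.
  by rewrite hT_out// h0 !scale0r graph_bar0.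
- have -> : hclass S (HAdd h k) = (hclass S h : hecke S) + hclass S k by rewrite -hclassD.
  by rewrite hbarD !scalerDl graph_barD IHh IHk.
- have -> : hclass S (HMul h k) = (hclass S h : hecke S) * hclass S k by rewrite -hclassM.
  by rewrite hbarM -!scalerA IHh IHk.
Qed.

Lemma std_elt_basis : is_basis I b.
Proof.
by apply: (unitri_basis hc) => w Iw; apply: (lspanS (std_elt_lspan I Q c w)).
Qed.

Lemma ideal_bar_graph_bar : ideal_bar b graph_bar.
Proof.
split; [exact: graph_barD|exact: graph_barZ|exact: graph_barK| |exact: graph_barH].
by rewrite std_elt1// graph_bar_basis//; exact: (ideal1 hWS hI).
Qed.

Variable ch : W -> W.
Hypothesis hch : valid_choice S I ch.
Hypothesis hrec : forall z, I z -> z <> 1%g -> recursion S I J Q (ch z) (ch z * z)%g.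

(** The recursion says T_s b_sz = b_z for the chosen descent s of z, and T_z is the product
    along the chosen descents as well as along any others. *)
Lemma std_elt_hTw w : I w -> b w = hTw hWS w *: c 1%g.
Proof.
elim/(@len_ind W S): w => z IH Iz.
have [->|z1] := pselect (z = 1%g); first by rewrite hTw1 scale1r std_elt1.
have [Ss Iw SAw] := choice_descent hch Iz z1.
have Tb := (recursionP hWS hI hJ hc Q0 hF Iw SAw).2 (hrec Iz z1).
have sw : (ch z * (ch z * z))%g = z by rewrite (genK hWS).
have [_ l] := hch Iz z1.
rewrite sw in Tb; rewrite -Tb IH// scalerA -hTw_mull ?sw//.
Qed.

(** The strong ascents and descents follow from b_w = T_w c_1. At a weak descent sw = wt
    with t in J, so that T_s T_w c_1 = T_w T_t c_1, and t is a weak descent of 1. At a weak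
    ascent (T_s - q) b_w is a combination over q Z[q] of the c_y with y < sw, and then also
    of the b_y. *)
Lemma ideal_basis_std_elt : ideal_basis I J b.
Proof.
split; first exact: std_elt_basis.
move=> s w Iw.
have SAact v : I v -> SA v s -> T s *: b v = b (s * v)%g.
  move=> Iv [Ss /blt_len l Isv].
  by rewrite !std_elt_hTw// scalerA -hTw_mull.
split.
- exact: SAact.
- move=> SDw; have Ss : S s by case: SDw.
  have := SAact _ (SD_ideal hWS hI Iw SDw) (SD_SA hWS Iw SDw); rewrite (genK hWS)// => e.
  by rewrite -e scalerA hT_quad// scalerDl scale1r /ascale scalerA -scalerAl mul1r.
- move=> [Ss /blt_len l nD].
  have [t Jt nt] : exists2 t, J t & ~ (len (s * w)%g < len (s * w * t)%g)%N.
    by have /existsNP[t /not_implyP[Jt nt]] := nD; exists t.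
  have [St posJ] := hJ Jt.
  have lwt := posJ _ Iw.
  have swt := deodhar hWS Ss St l lwt nt.
  rewrite std_elt_hTw// scalerA -hTw_mull// swt hTw_mulr// -scalerA.
  have I1 := ideal1 hWS hI.
  have WDt : WD 1%g t.
    have lt1 : (len 1%g < len (1 * t)%g)%N by exact: posJ.
    split=> //; first by apply/(blt_genP _ St); rewrite mulg1; rewrite mul1g in lt1.
    move=> /(_ t Jt); by rewrite mulg1 (gen_sq hWS)// (len1 hWS).
  have := hF St I1; rewrite /act_formula asboolT; last by right.
  by move=> ->; rewrite scalerN scale_ascale.
- move=> [Ss wz [Dz nI]]; have Aw : Asc w s by right.
  have h : lspan lqZq (below (s * w)%g) b (T s *: b w - lq *' b w).
    apply: (lspan_change (P := polyA) (b := c)).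
    - move=> u [Iu uz].
      apply: (lspanS (unitri_inv nu_subring_lqZq (fun w _ => std_elt_lspan I Q c w) Iu)).
        by move=> _ [p _ <-]; rewrite -rmorphM; exact: polyA_lpoly.
      exact: below_trans.
    - by move=> a p; exact: lqZqM.
    - have low := act_std_elt_lower hWS Ss wz (fun y hy => hF Ss hy.1).
      suff -> : T s *: b w - lq *' b w = T s *: (b w - c w) - lq *' (b w - c w) +
        \sum_(y \in lower_desc S I J s w) (c y *~ muQ Q y w) by [].
      have := hF Ss Iw; rewrite /act_formula asboolF; last exact: (Asc_not_Desc hJ Aw).
      rewrite /mu_part asboolF; last by case.
      rewrite add0r scalerBr ascaleBr => ->.
      by rewrite addrAC [- (lq *' c w + _)]opprD addrA subrK opprB subrKA.
  have e := coord_sum std_elt_basis nu_subring_lqZq (@below_sub _ _ _ _) (finite_below hWS I _) h.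
  exists (fun y => - coord std_elt_basis (T s *: b w - lq *' b w) y); split.
    move=> y Iy yz; apply: (nu_subringN nu_subring_lqZq).
    by have [] := lspan_coord std_elt_basis y nu_subring_lqZq (@below_sub _ _ _ _) h.
  apply/eqP; rewrite addrC -subr_eq; apply/eqP; rewrite [LHS]e.
  rewrite !fsbig_finite/=; try exact: finite_below.
  by rewrite -sumrN; apply: eq_bigr => y _; rewrite ascaleNl opprK.
Qed.

End Backward.

Lemma graph_produces_ideal : construction_produces_Wgraph S I J -> Wgraph_ideal S I J.
Proof.
move=> [ch [Q [hch /(constructionP _ hch)[Q0 hrec] [_ [M [c hM]]] hform]]].
have hF := (graph_formulasP hWS hJ Q c).1 (hform M c hM).
have hc : is_basis I c := hM.1.
exists M, (std_elt I Q c); split; first exact: (ideal_basis_std_elt hc hF Q0 hch hrec).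
by exists (graph_bar hc); exact: ideal_bar_graph_bar.
Qed.

End Directions.

Theorem theorem7p4 (W : groupType) (S : set W) (hWS : coxeter_system S)
    (I J : set W) (hI : left_ideal S I) (hJ : (J `<=` Pos S I)%classic) :
  Wgraph_ideal S I J <-> construction_produces_Wgraph S I J.
Proof.
split; first exact: ideal_produces_graph.
exact: graph_produces_ideal.
Qed.
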